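(* For the dynamical AND/OR-process on the rooted binary trees $\mathbb{T}_n$ of depth $n$, the sequence of root out-signal functions $\{f_n\}$ is Type 2 semi-volatile with respect to $p_n\equiv 1/2$. In particular, $\mathbb{P}(\forall t\in[0,1]:\ f_n(X^{(n)}(t))=1)$ is bounded away from $0$ and $1$ (uniformly in $n$).
   Context: AND/OR function: let $\mathbb{T}_n$ be the rooted binary tree of depth $n$, with $2^{n+1}-1$ vertices. At each vertex (including the leaves) there is a gate which is either an AND-gate or an OR-gate; identify state $1$ with OR and state $0$ with AND. Each leaf receives two in-signals, one equal to $0$ and one equal to $1$. Each gate outputs the AND, respectively the OR, of its two in-signals, and the in-signals of a non-leaf vertex are the out-signals of its two children. The Boolean function $f_n:\{0,1\}^{2^{n+1}-1}\to\{0,1\}$ maps the gate states to the out-signal of the root. Dynamics: with $p_n\equiv1/2$, $X^{(n)}(t)=\{X^{(n)}_v(t)\}_v$, $t\ge0$, where the gate states $X^{(n)}_v(t)$ are independent stationary continuous-time Markov chains on $\{0,1\}$ jumping from $0$ to $1$ at rate $1/2$ and from $1$ to $0$ at rate $1/2$. $C_n$ is the number of times $f_n(X^{(n)}(t))$ changes state during $[0,1]$. The sequence is semi-volatile if $\liminf_n\mathbb{P}(C_n=0)>0$ and $\lim_{M\to\infty}\liminf_{n\to\infty}\mathbb{P}(C_n>M)>0$. It is Type 2 semi-volatile if it is semi-volatile and for some $k\ge1$, $\limsup_{n\to\infty}\mathbb{P}(1\le C_n\le k)>0$. *)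

(* Defs.v *)
From HB Require Import structures.
From mathcomp Require Import all_boot all_order all_algebra.
From mathcomp Require Import all_classical all_reals all_analysis.
From mathcomp Require Import zify.
Set Implicit Arguments.
Unset Strict Implicit.
Unset Printing Implicit Defensive.
Import Order.TTheory GRing.Theory Num.Theory.
Import numFieldNormedType.Exports.
Local Open Scope classical_set_scope.
Local Open Scope ring_scope.

(* [None] is the root; [Some (inl v)] and [Some (inr v)] are the vertices of
   the two subtrees hanging from the children of the root. *)
Fixpoint vertex (n : nat) : finType :=
  if n is m.+1 then option (vertex m + vertex m) else unit.

Lemma card_vertex (n : nat) : #|vertex n| = (2 ^ n.+1 - 1)%N.
Proof.
elim: n => [|n IHn] /=; first by rewrite card_unit.
rewrite card_option card_sum IHn [in RHS]expnS.
by have := expn_gt0 2 n.+1; lia.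
Qed.

(* State [true] is an OR-gate, state [false] an AND-gate. *)
Definition gate (s a b : bool) : bool := if s then a || b else a && b.

Fixpoint andor (n : nat) : (vertex n -> bool) -> bool :=
  match n return (vertex n -> bool) -> bool with
  | 0 => fun x => gate (x tt) false true
  | m.+1 => fun x =>
      gate (x None) (andor (fun v : vertex m => x (Some (inl v))))
                    (andor (fun v : vertex m => x (Some (inr v))))
  end.

(* Time is [R] restricted to [0 <= t]; nothing is assumed, and nothing below
   depends, on what happens at negative times. *)
Definition cadlag (R : realType) (x : R -> bool) : Prop :=
  (forall t, 0 <= t -> \forall s \near t^'+, x s = x t) /\
  (forall t, 0 < t -> exists b, \forall s \near t^'-, x s = b).

(* [Q x y] is the rate of jumping from [x] to [y], for [x != y]; the diagonal
   of the generator is determined by [ts_mass]. *)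
Record transition_semigroup (R : realType) (Q : bool -> bool -> R)
    (p : R -> bool -> bool -> R) : Prop := TransitionSemigroup {
  ts_ge0 : forall t x y, 0 <= t -> 0 <= p t x y;
  ts_mass : forall t x, 0 <= t -> \sum_(y : bool) p t x y = 1;
  ts_0 : forall x y, p 0 x y = (x == y)%:R;
  ts_add : forall s t x z, 0 <= s -> 0 <= t ->
    p (s + t) x z = \sum_(y : bool) p s x y * p t y z;
  ts_rate : forall x y, x != y -> p h x y / h @[h --> 0^'+] --> Q x y }.

Definition history (R : realType) (T : Type) (X : R -> T -> bool) (I : set R) :
    set (set T) :=
  <<s [set A | exists t b, I t /\ A = X t @^-1` [set b]] >>.

Definition markov_property (R : realType) (d : measure_display)
    (T : measurableType d) (P : probability T R) (p : R -> bool -> bool -> R)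
    (X : R -> T -> bool) : Prop :=
  forall (s h : R) (x y : bool) (A : set T), 0 <= s -> 0 <= h ->
    history X `[0, s] A ->
    (P (A `&` X s @^-1` [set x] `&` X (s + h)%R @^-1` [set y]) =
     P (A `&` X s @^-1` [set x]) * (p h x y)%:E)%E.

Record stationary_chain (R : realType) (d : measure_display)
    (T : measurableType d) (P : probability T R) (Q : bool -> bool -> R)
    (X : R -> T -> bool) : Prop := StationaryChain {
  sc_measurable : forall t, 0 <= t -> measurable_fun setT (X t);
  sc_cadlag : forall w, cadlag (X ^~ w);
  sc_markov : exists2 p, transition_semigroup Q p & markov_property P p X;
  sc_stationary : forall t b, 0 <= t ->
    P (X t @^-1` [set b]) = P (X 0 @^-1` [set b]) }.

(* Since [V] is finite and each sigma-algebra contains [setT], the product rule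
   over all of [V] includes the product rule over every subfamily. *)
Definition independent_processes (R : realType) (d : measure_display)
    (T : measurableType d) (P : probability T R) (V : finType)
    (X : V -> R -> T -> bool) : Prop :=
  forall A : V -> set T, (forall v, history (X v) `[0, +oo[ (A v)) ->
    P (\bigcap_v A v) = (\prod_(v : V) P (A v))%E.

Definition flip_rate (R : realType) (p : R) (x y : bool) : R :=
  if y then p else 1 - p.

Definition gate_dynamics (R : realType) (d : measure_display)
    (T : measurableType d) (P : probability T R) (p : R) (V : finType)
    (X : V -> R -> T -> bool) : Prop :=
  (forall v, stationary_chain P (flip_rate p) (X v)) /\
  independent_processes P X.

Definition output (R : realType) (T : Type) (V : finType)
    (f : (V -> bool) -> bool) (X : V -> R -> T -> bool) (t : R) (w : T) : bool :=
  f (fun v => X v t w).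

(* For a cadlag path, the negated condition says that the left limit at [t]
   is the value at [t]. *)
Definition change_times (R : realType) (x : R -> bool) : set R :=
  [set t | 0 < t <= 1 /\ ~ \forall s \near t^'-, x s = x t].

Definition num_changes (R : realType) (T : Type) (V : finType)
    (f : (V -> bool) -> bool) (X : V -> R -> T -> bool) (w : T) : \bar R :=
  counting (change_times (fun t => output f X t w)).

Section Volatility.
Context (R : realType) (d : nat -> measure_display).
Context (T : forall n, measurableType (d n)) (P : forall n, probability (T n) R).
Context (C : forall n, T n -> \bar R).
Local Open Scope ereal_scope.

Definition semi_volatile : Prop :=
  0 < limn_einf (fun n => P n [set w | C w = 0]) /\
  0 < limn (fun M : nat => limn_einf (fun n => P n [set w | M%:R%:E < C w])).

Definition type2_semi_volatile : Prop :=
  semi_volatile /\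
  exists2 k : nat, (1 <= k)%N &
    0 < limn_esup (fun n => P n [set w | 1 <= C w <= k%:R%:E]).

End Volatility.

(* Main.v *)
Require Import Defs.
From mathcomp Require Import all_boot all_order all_algebra.
From mathcomp Require Import all_classical all_reals all_analysis.
From mathcomp Require Import ring lra zify.
Set Implicit Arguments.
Unset Strict Implicit.
Unset Printing Implicit Defensive.
Import Order.TTheory GRing.Theory Num.Theory.
Import numFieldNormedType.Exports.
Local Open Scope classical_set_scope.
Local Open Scope ring_scope.

(** The two subtrees at the root carry independent copies of the same process,
    so every statistic of the output obeys a recursion in the depth [n].

    Constancy.  Let [a] and [al] be the probabilities that the output is
    constantly [b] on a time window and on one half of it.  When the root stays
    in the state favouring [b], the output is constantly [b] also when one child
    is so on the first half and the other child on the second half; hence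
    [a' >= 2 q (a + (al - a)^2)], where [q] is the probability that the root stays
    in a given state.  Comparing windows of all dyadic lengths gives
    [a >= 1/2 - 3 sqrt t] for length [t], uniformly in [n].  Applying the same
    inequality as [a' >= q al^2] a fixed number of times passes from short windows
    to [[0, 1]].

    One to three changes.  If the children are constantly 1 and 0, the output is
    the root gate.

    Many changes.  The probability [r] that the output differs at two times at
    distance [s] satisfies an exact recursion whose fixed point is of order
    [sqrt s].  Changes in two steps of length [h] at distance [s] must essentially
    come from the same child, the other one being neutral both times, so the
    probability of a change in both contracts by [1 - r] per level and is
    [O(h / sqrt s)] in the limit.  On a mesh of [K] steps the number of changes
    then has mean at least [sqrt K / 4] and second moment [O(K)]. *)

(** * Finite laws *)

(** Uniformity in two parameters shapes the proof: bounds must hold at every depth and survive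
    refinement of the mesh. Constancy, and the gap between [P(N > 3)] and [P(N > 0)] for the mesh
    count [N], are therefore bounded on every mesh of [2^m] steps with constants free of [m], and
    monotone limits follow. For many changes one fixed mesh suffices, since a mesh can only miss
    changes; there the required depth may depend on the mesh.

    The two halves of a window are dependent within one child, so they are assigned to different
    children. The scale [sqrt t] comes from a balance: a flipping root costs about [t / 4] per
    level, while the gain is the square of the difference between a half window and the whole one. A
    deficit [3 sqrt t] makes that difference at least [3 sqrt t / 4], and the gain [9 t / 16] wins.

    In the second moment, the decay [h / sqrt s] is summable enough: over all pairs of steps it
    gives order [K], the order of the squared mean, so a truncated second-moment argument
    applies. *)

Section FiniteExpectation.
Context {R : realType}.
Implicit Types (A B C : finType).

Definition Ex A (mu f : A -> R) : R := \sum_a mu a * f a.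

Definition prod3 A B C (mu : A -> R) (nu : B -> R) (xi : C -> R) (x : A * B * C) : R :=
  mu x.1.1 * nu x.1.2 * xi x.2.

Definition tensor3 A B C (f : A -> R) (g : B -> R) (k : C -> R) (x : A * B * C) : R :=
  f x.1.1 * g x.1.2 * k x.2.

Section Fixed.
Variables (A : finType) (mu : A -> R).

Lemma ExD f g : Ex mu (fun a => f a + g a) = Ex mu f + Ex mu g.
Proof. by rewrite -big_split; apply: eq_bigr => a _; rewrite mulrDr. Qed.

Lemma ExZ c f : Ex mu (fun a => c * f a) = c * Ex mu f.
Proof. by rewrite mulr_sumr; apply: eq_bigr => a _; rewrite mulrCA. Qed.

Lemma ExN f : Ex mu (fun a => - f a) = - Ex mu f.
Proof. by rewrite -sumrN; apply: eq_bigr => a _; rewrite mulrN. Qed.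

Lemma ExB f g : Ex mu (fun a => f a - g a) = Ex mu f - Ex mu g.
Proof. by rewrite ExD ExN. Qed.

Lemma Ex_sum I (r : seq I) (P : pred I) (F : I -> A -> R) :
  Ex mu (fun a => \sum_(i <- r | P i) F i a) = \sum_(i <- r | P i) Ex mu (F i).
Proof. by rewrite exchange_big; apply: eq_bigr => a _; rewrite mulr_sumr. Qed.

Lemma Ex_le f g : (forall a, 0 <= mu a) -> (forall a, f a <= g a) -> Ex mu f <= Ex mu g.
Proof. by move=> mu0 fg; apply: ler_sum => a _; rewrite ler_wpM2l. Qed.

Lemma eq_Ex f g : f =1 g -> Ex mu f = Ex mu g.
Proof. by move=> fg; apply: eq_bigr => a _; rewrite fg. Qed.

End Fixed.

Lemma Ex_tensor3 A B C (mu : A -> R) (nu : B -> R) (xi : C -> R) f g k :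
  Ex (prod3 mu nu xi) (tensor3 f g k) =
  Ex mu f * Ex nu g * Ex xi k.
Proof.
transitivity (\sum_a mu a * f a * (\sum_b nu b * g b * Ex xi k)); last first.
  by rewrite -!mulr_suml mulrA.
rewrite /Ex /tensor3 -(pair_big xpredT xpredT (fun x c =>
  prod3 mu nu xi (x, c) * (f x.1 * g x.2 * k c)))/=.
rewrite -(pair_big xpredT xpredT (fun a b =>
  \sum_c prod3 mu nu xi (a, b, c) * (f a * g b * k c)))/=.
apply: eq_bigr => a _; rewrite mulr_sumr; apply: eq_bigr => b _.
by rewrite !mulr_sumr; apply: eq_bigr => c _; rewrite /prod3/=; ring.
Qed.

End FiniteExpectation.

Section FiniteLaw.
Context {R : realType} {d : measure_display} {T : measurableType d}.
Variable P : probability T R.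

Definition proba (A : set T) : R := fine (P A).

Definition fin_measurable (A : finType) (Z : T -> A) : Prop :=
  forall a, measurable (Z @^-1` [set a]).

Definition pmf (A : finType) (Z : T -> A) (a : A) : R := proba (Z @^-1` [set a]).

Lemma probaE A : measurable A -> P A = (proba A)%:E.
Proof. by move=> mA; rewrite /proba fineK ?fin_num_measure. Qed.

Lemma proba_ge0 A : 0 <= proba A.
Proof. by rewrite /proba fine_ge0. Qed.

Lemma proba_setT : proba setT = 1.
Proof. by rewrite /proba probability_setT. Qed.

Lemma proba_set0 : proba set0 = 0.
Proof. by rewrite /proba measure0. Qed.

Lemma le_proba A B : measurable A -> measurable B -> A `<=` B -> proba A <= proba B.
Proof.
move=> mA mB AB; rewrite -lee_fin -!probaE//.
by apply: le_measure => //; rewrite inE.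
Qed.

Lemma proba_le1 A : measurable A -> proba A <= 1.
Proof. by move=> mA; rewrite -proba_setT; apply: le_proba. Qed.

Lemma probaU A B : measurable A -> measurable B -> A `&` B = set0 ->
  proba (A `|` B) = proba A + proba B.
Proof.
move=> mA mB AB; rewrite /proba measureU// fineD//; exact: fin_num_measure.
Qed.

Section OneVariable.
Variables (A : finType) (Z : T -> A).
Hypothesis mZ : fin_measurable Z.

Lemma measurable_seq_preimage (r : seq A) : measurable [set w | Z w \in r].
Proof.
elim: r => [|a r IH]; first by rewrite [X in measurable X](_ : _ = set0)//; apply/seteqP; split.
rewrite [X in measurable X](_ : _ = Z @^-1` [set a] `|` [set w | Z w \in r]).
  exact: measurableU.
apply/seteqP; split => w /=; rewrite inE.
  by case/orP => [/eqP|]; [left|right].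
by case => [->|->]; rewrite ?eqxx ?orbT.
Qed.

Lemma measurable_fin_event (E : pred A) : measurable [set w | E (Z w)].
Proof.
rewrite [X in measurable X](_ : _ = [set w | Z w \in enum E]).
  exact: measurable_seq_preimage.
by apply/seteqP; split => w /=; rewrite mem_enum.
Qed.

Lemma proba_fin_event (E : pred A) :
  proba [set w | E (Z w)] = Ex (pmf Z) (fun a => (E a)%:R).
Proof.
have seqE (r : seq A) : uniq r -> proba [set w | Z w \in r] = \sum_(a <- r) pmf Z a.
  elim: r => [|a r IH] /= => [_|/andP[ar ur]].
    by rewrite big_nil -proba_set0; congr proba; apply/seteqP; split.
  rewrite big_cons -IH// -probaU//; first last.
  - by apply/seteqP; split => w //= -[-> zr]; rewrite zr in ar.
  - exact: measurable_seq_preimage.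
  congr proba; apply/seteqP; split => w /=; rewrite inE.
    by case/orP => [/eqP|]; [left|right].
  by case => [->|->]; rewrite ?eqxx ?orbT.
rewrite [X in proba X](_ : _ = [set w | Z w \in enum E]); last first.
  by apply/seteqP; split => w /=; rewrite mem_enum.
rewrite seqE ?enum_uniq// big_enum/= /Ex [RHS](bigID E)/=.
rewrite [X in _ + X]big1 ?addr0; last by move=> a /negbTE ->; rewrite mulr0.
by apply: eq_bigr => a; rewrite unfold_in => ->; rewrite mulr1.
Qed.

Lemma pmf_ge0 a : 0 <= pmf Z a.
Proof. exact: proba_ge0. Qed.

Lemma Ex_cst c : Ex (pmf Z) (fun=> c) = c.
Proof.
have e1 : Ex (pmf Z) (fun=> 1) = 1.
  rewrite -[RHS]proba_setT -[LHS](proba_fin_event predT).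
  by congr proba; apply/seteqP; split.
by rewrite -[RHS]mulr1 -[X in _ * X]e1 -ExZ; apply: eq_Ex => a; rewrite mulr1.
Qed.

Lemma Ex_pmf_le f g : (forall a, f a <= g a) -> Ex (pmf Z) f <= Ex (pmf Z) g.
Proof. by move=> fg; apply: Ex_le => // a; exact: pmf_ge0. Qed.

Lemma fin_measurable_comp (B : finType) (g : A -> B) : fin_measurable (g \o Z).
Proof.
move=> b; rewrite [X in measurable X](_ : _ = [set w | (g (Z w)) == b]).
  exact: (measurable_fin_event (fun a => g a == b)).
by apply/seteqP; split => w /= => [->|/eqP].
Qed.

Lemma Ex_comp (B : finType) (g : A -> B) f :
  Ex (pmf (g \o Z)) f = Ex (pmf Z) (f \o g).
Proof.
rewrite [RHS](_ : _ = Ex (pmf Z) (fun a => \sum_b f b * (g a == b)%:R)); last first.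
  apply: eq_Ex => a; rewrite (bigD1 (g a))//= eqxx mulr1 big1 ?addr0// => b.
  by rewrite eq_sym => /negbTE ->; rewrite mulr0.
rewrite Ex_sum; apply: eq_bigr => b _; rewrite ExZ mulrC; congr (_ * _).
rewrite -(proba_fin_event (fun a => g a == b)) /pmf; congr proba.
by apply/seteqP; split => w /= => [->|/eqP].
Qed.

End OneVariable.

(** Independence survives coordinatewise maps. The dynamics give independence of gate paths; this
    carries it to functions of them such as the outputs of the two subtrees. *)
Lemma pmf_prod3_comp (A B C A' B' C' : finType) (S : T -> A) (L : T -> B)
    (V : T -> C) (f : A -> A') (g : B -> B') (k : C -> C') :
  fin_measurable S -> fin_measurable L -> fin_measurable V ->
  fin_measurable (fun w => (S w, L w, V w)) ->
  pmf (fun w => (S w, L w, V w)) =1 prod3 (pmf S) (pmf L) (pmf V) ->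
  pmf (fun w => (f (S w), g (L w), k (V w))) =1
  prod3 (pmf (f \o S)) (pmf (g \o L)) (pmf (k \o V)).
Proof.
move=> mS mL mV mSLV e [[a b] c].
pose i (X : finType) (x y : X) : R := (x == y)%:R.
have distE (X Y : finType) (Z : T -> X) (h : X -> Y) y : fin_measurable Z ->
    pmf (h \o Z) y = Ex (pmf Z) (fun x => i _ (h x) y).
  move=> mZ; rewrite -(proba_fin_event mZ (fun x => h x == y)); congr proba.
  by apply/seteqP; split => w /= => [->|/eqP].
rewrite /prod3/= !distE// -Ex_tensor3 -[LHS]/(pmf ((fun x : A * B * C =>
  (f x.1.1, g x.1.2, k x.2)) \o (fun w => (S w, L w, V w))) _) distE//.
apply: eq_bigr => -[[x y] z] _; rewrite e; congr (_ * _).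
by rewrite /i /tensor3/= !xpair_eqE; do 3 case: eqP => _; rewrite /= ?mulr1 ?mul0r ?mulr0.
Qed.

End FiniteLaw.

(** * The chain of a single gate *)

Section FlipProbability.
Context {R : realType}.
Implicit Types s t h : R.

(** Probability that a two-state chain with both rates 1/2, hence relaxation rate 1, is in the other
    state after time [t]. *)
Definition flip_prob t : R := (1 - expR (- t)) / 2.

Lemma flip_prob0 : flip_prob 0 = 0.
Proof. by rewrite /flip_prob oppr0 expR0; lra. Qed.

Lemma flip_prob_le t : flip_prob t <= t / 2.
Proof. by rewrite /flip_prob; have := expR_ge1Dx (- t); lra. Qed.

Lemma flip_prob_lt_half t : flip_prob t < 1 / 2.
Proof. by rewrite /flip_prob; have := expR_gt0 (- t); lra. Qed.

Lemma le_flip_prob s t : s <= t -> flip_prob s <= flip_prob t.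
Proof. by move=> st; rewrite /flip_prob ler_pM2r ?invr_gt0// lerB// ler_expR lerN2. Qed.

Lemma flip_prob_ge0 t : 0 <= t -> 0 <= flip_prob t.
Proof. by move=> t0; rewrite -flip_prob0; exact: le_flip_prob. Qed.

Lemma expRN_bounds h : 0 <= h -> h * (1 - h) <= 1 - expR (- h) <= h.
Proof.
move=> h0; have e1 := expR_ge1Dx h; have e2 := expR_ge1Dx (- h).
have e3 : expR h * expR (- h) = 1 by rewrite -expRD subrr expR0.
have e4 := expR_gt0 (- h); apply/andP; split; last lra.
have e5 : (1 + h) * expR (- h) <= 1 by rewrite -[leRHS]e3 ler_pM2r.
nra.
Qed.

Lemma flip_prob_ge t : 0 <= t <= 1 -> t / 4 <= flip_prob t.
Proof.
move=> t01; rewrite /flip_prob; have e1 := expR_ge1Dx t.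
have e3 : expR t * expR (- t) = 1 by rewrite -expRD subrr expR0.
have e4 := expR_gt0 (- t).
have e5 : (1 + t) * expR (- t) <= 1 by rewrite -[leRHS]e3 ler_pM2r.
nra.
Qed.

Lemma norm_exprnB_le (a b : R) n : `|a| <= 1 -> `|b| <= 1 ->
  `|a ^+ n - b ^+ n| <= n%:R * `|a - b|.
Proof.
move=> a1 b1; elim: n => [|n IH]; first by rewrite !expr0 subrr normr0 mul0r.
rewrite !exprS (_ : _ - _ = a * (a ^+ n - b ^+ n) + (a - b) * b ^+ n); last ring.
rewrite (le_trans (ler_normD _ _))// !normrM -natr1 mulrDl mul1r lerD//.
  by rewrite (le_trans _ IH)// ler_piMl.
by rewrite ler_piMr// normrX exprn_ile1.
Qed.

(** Regularity is given only at 0. Writing [t = n h], the two [n]-th powers differ by at most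
    [n |D h - expR (- h)|]; both [1 - D h] and [1 - expR (- h)] are within [e h / (2 t)] of [h], so
    the total error is at most [n h e / t = e]. *)
Lemma multiplicative_expRN (D : R -> R) : D 0 = 1 ->
  (forall s t, 0 <= s -> 0 <= t -> D (s + t) = D s * D t) ->
  (forall t, 0 <= t -> `|D t| <= 1) ->
  (1 - D h) / h @[h --> 0^'+] --> (1 : R) ->
  forall t, 0 <= t -> D t = expR (- t).
Proof.
move=> D0 DM D1 D' t; rewrite le_eqVlt => /predU1P[<-|t0].
  by rewrite oppr0 expR0.
have DX h n : 0 <= h -> D (n%:R * h) = D h ^+ n.
  move=> h0; elim: n => [|n IH]; first by rewrite mul0r expr0.
  by rewrite -natr1 mulrDl mul1r DM ?mulr_ge0// IH exprSr.
apply/eqP; rewrite -subr_eq0 -normr_eq0 eq_le normr_ge0 andbT.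
apply/ler_addgt0Pl => e e0; rewrite addr0.
have eta0 : 0 < e / (2 * t) by rewrite divr_gt0// mulr_gt0.
have /cvgrPdist_lt/(_ _ eta0) := D'.
move=> [r /= r0 near0].
pose n := (Num.truncn (t / Num.min r (e / (2 * t)))).+1.
have m0 : 0 < Num.min r (e / (2 * t)) by rewrite lt_min r0.
have n0 : (0 : R) < n%:R by rewrite ltr0n.
pose h := t / n%:R.
have h0 : 0 < h by rewrite divr_gt0.
have : h < Num.min r (e / (2 * t)).
  by rewrite ltr_pdivrMr// mulrC -ltr_pdivrMr// truncnS_gt.
rewrite lt_min => /andP[hr he].
have tE : t = n%:R * h by rewrite /h mulrC divfK// gt_eqF.
have eX : expR (- t) = expR (- h) ^+ n by rewrite tE -mulrN expRM_natl.
rewrite {1}tE DX ?(ltW h0)// eX (le_trans (norm_exprnB_le _ _ _))//.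
- by apply: D1; exact: ltW.
- rewrite ger0_norm ?expR_ge0// -expR0 ler_expR; lra.
have d1 : `|1 - D h - h| <= e / (2 * t) * h.
  have /= := near0 h; rewrite sub0r normrN gtr0_norm// => /(_ hr h0) /ltW.
  rewrite distrC -(ler_pM2r h0) -[X in _ * X <= _](gtr0_norm h0) -normrM.
  by rewrite mulrBl divfK ?gt_eqF// mul1r.
have d2 : `|1 - expR (- h) - h| <= e / (2 * t) * h.
  have /andP[h1 h2] := expRN_bounds (ltW h0).
  rewrite ler_norml; apply/andP; split; nra.
have -> : D h - expR (- h) = (1 - expR (- h) - h) - (1 - D h - h) by ring.
have nt : n%:R * (e / (2 * t) * h) = e / 2.
  by rewrite mulrCA -tE; field; rewrite gt_eqF.
have := ler_normB (1 - expR (- h) - h) (1 - D h - h).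
move=> /(ler_wpM2l (ltW n0)) /le_trans; apply.
by rewrite mulrDr; have := ler_wpM2l (ltW n0) d1; have := ler_wpM2l (ltW n0) d2; lra.
Qed.

Definition transition t (x y : bool) : R := if x == y then 1 - flip_prob t else flip_prob t.

End FlipProbability.

Section History.
Context {R : realType} {T : Type} (X : R -> T -> bool).

Lemma historyI I (A B : set T) : history X I A -> history X I B -> history X I (A `&` B).
Proof.
have /sigma_algebraP[] // := smallest_sigma_algebra setT
  [set A | exists t b, I t /\ A = X t @^-1` [set b]].
by move=> _ _ _ sI; exact: sI.
Qed.

Lemma historyT I : history X I setT.
Proof. by rewrite -[setT]setD0; apply: sigma_algebraCD; exact: sigma_algebra0. Qed.

Lemma historyC I A : history X I A -> history X I (~` A).
Proof. by rewrite -setTD => hA; exact: sigma_algebraCD. Qed.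

Lemma history_event (I : set R) t b : I t -> history X I (X t @^-1` [set b]).
Proof. by move=> It; apply: sub_sigma_algebra; exists t, b. Qed.

Lemma history_fdd (I : set R) (ts : nat -> R) (b : nat -> bool) K :
  (forall i, (i < K)%N -> I (ts i)) ->
  history X I [set w | forall i, (i < K)%N -> X (ts i) w = b i].
Proof.
elim: K => [|K IH] Its.
  rewrite [X in history _ _ X](_ : _ = setT); first exact: historyT.
  by apply/seteqP; split.
rewrite [X in history _ _ X](_ : _ =
    [set w | forall i, (i < K)%N -> X (ts i) w = b i] `&` X (ts K) @^-1` [set b K]).
  apply: historyI; last by apply: history_event; exact: Its.
  by apply: IH => i iK; apply: Its; exact: ltnW.
apply/seteqP; split => w /=.
  by move=> H; split; [move=> i iK; apply: H; exact: ltnW|exact: H].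
by move=> [H HK] i; rewrite ltnS leq_eqVlt => /predU1P[->//|/H].
Qed.

End History.

Section Chain.
Context {R : realType} {d : measure_display} {T : measurableType d}.
Variables (P : probability T R) (X : R -> T -> bool).
Hypothesis HX : stationary_chain P (flip_rate (1 / 2)) X.

Local Notation pr := (proba P).

Lemma chain_measurable t b : 0 <= t -> measurable (X t @^-1` [set b]).
Proof. by move=> t0; rewrite -[X in measurable X]setTI; exact: (sc_measurable HX t0). Qed.

Lemma history_measurable (I : set R) A : (forall t, I t -> 0 <= t) ->
  history X I A -> measurable A.
Proof.
move=> I0; apply: smallest_sub; first exact: sigma_algebra_measurable.
by move=> _ [t [b [It ->]]]; apply: chain_measurable; exact: I0.
Qed.

(** The hypotheses fix the chain only through jump rates and stationarity. Stationarity gives the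
    balance relation [bal]; divided by [h] it forces equal marginals as [h] tends to 0. The
    semigroup is then symmetric, and its nontrivial eigenvalue [1 - 2 p h true false] is
    multiplicative with slope -1 at 0, hence exponential. *)
Lemma chain_marginal_markov :
  (forall t b, 0 <= t -> pr (X t @^-1` [set b]) = 1 / 2) /\
  (forall s h x y A, 0 <= s -> 0 <= h -> history X `[0, s] A ->
    pr (A `&` X s @^-1` [set x] `&` X (s + h) @^-1` [set y]) =
    pr (A `&` X s @^-1` [set x]) * transition h x y).
Proof.
have [p tp mp] := sc_markov HX.
have mpr s h x y A : 0 <= s -> 0 <= h -> history X `[0, s] A ->
    pr (A `&` X s @^-1` [set x] `&` X (s + h) @^-1` [set y]) =
    pr (A `&` X s @^-1` [set x]) * p h x y.
  move=> s0 h0 hA.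
  have mA : measurable A.
    by apply: history_measurable hA => t /=; rewrite in_itv/= => /andP[].
  have mAx : measurable (A `&` X s @^-1` [set x]).
    by apply: measurableI => //; exact: chain_measurable.
  have := mp s h x y A s0 h0 hA.
  rewrite probaE; last by apply: measurableI => //; apply: chain_measurable; lra.
  by rewrite probaE// -EFinM => -[].
have split_pr t A : 0 <= t -> measurable A ->
    pr A = pr (A `&` X t @^-1` [set true]) + pr (A `&` X t @^-1` [set false]).
  move=> t0 mA; rewrite -probaU.
  - congr proba; apply/seteqP; split => w /=; last by case => -[].
    by move=> Aw; case: (X t w); [left|right].
  - by apply: measurableI => //; exact: chain_measurable.
  - by apply: measurableI => //; exact: chain_measurable.
  - by apply/seteqP; split => w //= -[[_ ->] []].
have stat t b : 0 <= t -> pr (X t @^-1` [set b]) = pr (X 0 @^-1` [set b]).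
  by move=> t0; rewrite /proba (sc_stationary HX).
set pt := pr (X 0 @^-1` [set true]); set pf := pr (X 0 @^-1` [set false]).
have sum1 : pt + pf = 1.
  by rewrite /pt /pf -(proba_setT P) (split_pr 0 setT)// !setTI.
have mass h x : 0 <= h -> p h x true + p h x false = 1.
  by move=> h0; rewrite -(ts_mass tp x h0) big_bool.
have bal h : 0 <= h -> pf * p h false true = pt * p h true false.
  move=> h0; have := split_pr 0 (X h @^-1` [set true]) (lexx 0) (chain_measurable _ h0).
  rewrite stat// ![X h @^-1` _ `&` _]setIC.
  have m0 x := mpr 0 h x true setT (lexx 0) h0 (@historyT _ _ _ _).
  move: (m0 true) (m0 false); rewrite !setTI add0r => -> ->; rewrite -/pt -/pf.
  have := mass h true h0; nra.
have ptf : pt = pf.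
  have := @ts_rate _ _ _ tp true false isT; have := @ts_rate _ _ _ tp false true isT.
  rewrite /flip_rate => /(cvgMl_tmp (a := pf)) cf /(cvgMl_tmp (a := pt)) ct.
  suff : pf * (1 / 2) = pt * (1 - 1 / 2) by lra.
  apply: (cvg_unique _ cf) => //; apply: cvg_trans ct; apply: near_eq_cvg.
  by near=> h; rewrite !mulrA bal.
have marg t b : 0 <= t -> pr (X t @^-1` [set b]) = 1 / 2.
  by move=> t0; rewrite stat//; case: b; rewrite -/pt -/pf; lra.
have sym h : 0 <= h -> p h false true = p h true false.
  by move=> h0; have := bal h h0; rewrite ptf (_ : pf = 1 / 2); lra.
have DE u : 0 <= u -> 1 - 2 * p u true false = expR (- u).
  apply: (@multiplicative_expRN _ (fun h => 1 - 2 * p h true false)).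
  - by rewrite (ts_0 tp)/=; lra.
  - move=> s t s0 t0; rewrite (ts_add tp)// big_bool/=.
    have := sym s s0; have := sym t t0.
    by have := mass s true s0; have := mass t true t0; have := mass s false s0;
       have := mass t false t0; nra.
  - move=> t t0; rewrite ler_norml.
    have := mass t true t0; have := ts_ge0 tp true true t0.
    by have := ts_ge0 tp true false t0; lra.
  - have := @ts_rate _ _ _ tp true false isT.
    move=> /(cvgMl_tmp (a := 2)); rewrite (_ : 2 * _ = 1); last by rewrite /flip_rate; lra.
    by apply: cvg_trans; apply: near_eq_cvg; near=> z; lra.
split => // s h x y A s0 h0 hA; rewrite mpr//; congr (_ * _).
have := DE h h0; have := sym h h0; have := mass h true h0; have := mass h false h0.
by rewrite /transition /flip_prob; case: x; case: y => /=; lra.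
Unshelve. all: by end_near. Qed.

Lemma chain_marginal t b : 0 <= t -> pr (X t @^-1` [set b]) = 1 / 2.
Proof. exact: chain_marginal_markov.1. Qed.

Lemma chain_markov s h x y A : 0 <= s -> 0 <= h -> history X `[0, s] A ->
  pr (A `&` X s @^-1` [set x] `&` X (s + h) @^-1` [set y]) =
  pr (A `&` X s @^-1` [set x]) * transition h x y.
Proof. exact: chain_marginal_markov.2. Qed.

(** Times may repeat, since [transition 0] is the identity; one-time and two-time laws are later
    read off from such degenerate grids. *)
Lemma chain_fdd (ts : nat -> R) (b : nat -> bool) K :
  0 <= ts 0 -> (forall i, ts i <= ts i.+1) ->
  pr [set w | forall i, (i < K.+1)%N -> X (ts i) w = b i] =
  1 / 2 * \prod_(i < K) transition (ts i.+1 - ts i) (b i) (b i.+1).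
Proof.
move=> ts0 tsS.
have tsmono i j : (i <= j)%N -> ts i <= ts j.
  elim: j => [|j IH]; first by rewrite leqn0 => /eqP ->.
  by rewrite leq_eqVlt => /predU1P[->//|ij]; apply: le_trans (tsS j); exact: IH.
have tsge0 i : 0 <= ts i by apply: le_trans ts0 _; exact: tsmono.
elim: K => [|K IH].
  rewrite big_ord0 mulr1 -(chain_marginal (b 0) ts0); congr proba.
  apply/seteqP; split => w /=; first by move/(_ 0 isT).
  by move=> H i; rewrite ltnS leqn0 => /eqP ->.
rewrite big_ord_recr/= mulrA -IH.
have E k : [set w | forall i, (i < k.+1)%N -> X (ts i) w = b i] =
    [set w | forall i, (i < k)%N -> X (ts i) w = b i] `&` X (ts k) @^-1` [set b k].
  apply/seteqP; split => w /=.
    by move=> H; split; [move=> i iK; apply: H; exact: ltnW|exact: H].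
  by move=> [H HK] i; rewrite ltnS leq_eqVlt => /predU1P[->//|/H].
rewrite E E; have := @chain_markov (ts K) (ts K.+1 - ts K) (b K) (b K.+1)
  [set w | forall i, (i < K)%N -> X (ts i) w = b i] (tsge0 K).
rewrite [ts K + _]addrC subrK subr_ge0 => -> //.
apply: history_fdd => i iK /=; rewrite in_itv/= tsge0/=; apply: tsmono; exact: ltnW.
Qed.

(** By symmetry the flip probability is the same from both states, so a flip is independent of the
    whole past, the present state included. *)
Lemma chain_flip s h A : 0 <= s -> 0 <= h -> history X `[0, s] A ->
  pr (A `&` [set w | X s w != X (s + h) w]) = pr A * flip_prob h.
Proof.
move=> s0 h0 hA.
have mA : measurable A.
  by apply: history_measurable hA => t /=; rewrite in_itv/= => /andP[].
have sh0 : 0 <= s + h by lra.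
have mX := chain_measurable.
rewrite [X in pr X](_ : _ =
  (A `&` X s @^-1` [set true] `&` X (s + h) @^-1` [set false]) `|`
  (A `&` X s @^-1` [set false] `&` X (s + h) @^-1` [set true])); last first.
  apply/seteqP; split => w /=.
    by move=> [Aw]; case: (X s w); case: (X (s + h) w) => // _; [left|right].
  by move=> [[[Aw ->] ->]|[[Aw ->] ->]].
rewrite probaU ?chain_markov//; first last.
- by apply/seteqP; split => w //= -[[[_ ->] _] [[_]]].
- by apply: measurableI; [apply: measurableI => //; exact: mX|exact: mX].
- by apply: measurableI; [apply: measurableI => //; exact: mX|exact: mX].
rewrite /transition/= -mulrDl -probaU; first last.
- by apply/seteqP; split => w //= -[[_ ->] []].
- by apply: measurableI => //; exact: mX.
- by apply: measurableI => //; exact: mX.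
congr (proba _ _ * _); apply/seteqP; split => w /=; last by case: (X s w) => Aw; [left|right].
by case => -[].
Qed.

End Chain.

(** * Independence of the two subtrees *)

Section Trajectory.
Context {R : realType} {T : Type}.
Implicit Types (Y : R -> T -> bool) (ts : nat -> R).

Definition traj Y ts K (w : T) : {ffun 'I_K.+1 -> bool} := finfun (fun i : 'I_K.+1 => Y (ts i) w).

Definition gate_path K (x : {ffun 'I_K.+1 -> bool} * {ffun 'I_K.+1 -> bool} *
    {ffun 'I_K.+1 -> bool}) : {ffun 'I_K.+1 -> bool} :=
  [ffun i => gate (x.1.1 i) (x.1.2 i) (x.2 i)].

(** Path law of a single gate. Only the gaps between successive times enter, which is the source of
    all shift invariance below. *)
Definition chain_weight ts K (a : {ffun 'I_K.+1 -> bool}) : R :=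
  1 / 2 * \prod_(i < K) transition (ts i.+1 - ts i) (a (inord i)) (a (inord i.+1)).

Arguments chain_weight ts K a : clear implicits.

(** The law of the output path computed without reference to a probability space. It lets left and
    right subtrees, and a window and its translates, be compared by comparing the gate law [mu]
    alone. *)
Fixpoint law K (mu : {ffun 'I_K.+1 -> bool} -> R) n : {ffun 'I_K.+1 -> bool} -> R :=
  if n is m.+1 then fun c =>
    Ex (prod3 mu (law mu m) (law mu m)) (fun x => (gate_path x == c)%:R)
  else mu.

Lemma traj_preimage Y ts K a :
  traj Y ts K @^-1` [set a] =
  [set w | forall i, (i < K.+1)%N -> Y (ts i) w = a (inord i)].
Proof.
apply/seteqP; split => w /=.
  by move=> <- i iK; rewrite ffunE inordK.
by move=> H; apply/ffunP => i; rewrite ffunE H// inord_val.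
Qed.

Lemma chain_weight_shift ts c K : chain_weight (fun i => ts i + c) K = chain_weight ts K.
Proof.
apply/funext => a; congr (_ * _); apply: eq_bigr => i _; congr transition; ring.
Qed.

End Trajectory.
Arguments chain_weight {R} ts K a.

Lemma big_option_sum (R : realType) (V1 V2 : finType) (F : option (V1 + V2) -> R) :
  \prod_v F v = F None * (\prod_v F (Some (inl v)) * \prod_v F (Some (inr v))).
Proof.
rewrite (bigD1 None)//=; congr (_ * _).
rewrite (reindex_omap Some id); last by case.
transitivity (\prod_v F (Some v)); last by rewrite big_sumType.
by apply: eq_bigl => v; rewrite eqxx.
Qed.

Section Dynamics.
Context {R : realType} {d : measure_display} {T : measurableType d}.
Variables (P : probability T R).
Local Notation pr := (proba P).
Local Notation dist := (pmf P).
Local Notation GD := (gate_dynamics P (1 / 2)).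

Lemma indep_pr (V : finType) (X : V -> R -> T -> bool) (A : V -> set T) : GD X ->
  (forall v, history (X v) `[0, +oo[ (A v)) ->
  pr (\bigcap_v A v) = \prod_v pr (A v).
Proof.
move=> [HX iX] hA; rewrite /proba iX//.
rewrite (eq_bigr (fun v => (pr (A v))%:E)) ?prodEFin// => v _.
rewrite probaE//; apply: history_measurable (hA v); first exact: HX.
by move=> t /=; rewrite in_itv/= andbT.
Qed.

Lemma indep_pr3 (V1 V2 : finType) (X : option (V1 + V2) -> R -> T -> bool)
    (A0 : set T) (A1 : V1 -> set T) (A2 : V2 -> set T) : GD X ->
  history (X None) `[0, +oo[ A0 ->
  (forall v, history (X (Some (inl v))) `[0, +oo[ (A1 v)) ->
  (forall v, history (X (Some (inr v))) `[0, +oo[ (A2 v)) ->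
  pr (A0 `&` (\bigcap_v A1 v `&` \bigcap_v A2 v)) =
  pr A0 * (\prod_v pr (A1 v) * \prod_v pr (A2 v)).
Proof.
move=> HX h0 h1 h2.
pose A v := match v with
  | None => A0 | Some (inl v) => A1 v | Some (inr v) => A2 v end.
have := @indep_pr _ X A HX; rewrite big_option_sum/= => <-.
  congr proba; apply/seteqP; split => w /=.
    by move=> [H0 [H1 H2]] [[v|v]|] _; [exact: H1|exact: H2|exact: H0].
  move=> H; split; first exact: (H None I).
  by split => v _; [exact: (H (Some (inl v)) I)|exact: (H (Some (inr v)) I)].
by case=> [[v|v]|]; [exact: h1|exact: h2|exact: h0].
Qed.

Lemma bigcap_measurable_fin (V : finType) (A : V -> set T) :
  (forall v, measurable (A v)) -> measurable (\bigcap_v A v).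
Proof.
by move=> mA; apply: fin_bigcap_measurable => // v _; exact: mA.
Qed.

(** The product rule inside a subtree is the full product rule with [setT] at every other vertex. *)
Lemma gate_dynamics_subtrees (V1 V2 : finType) (X : option (V1 + V2) -> R -> T -> bool) :
  GD X -> GD (fun v => X (Some (inl v))) /\ GD (fun v => X (Some (inr v))).
Proof.
move=> HX; have [cX _] := HX.
have m (V : finType) (Y : V -> R -> T ->
  bool) A : (forall v, stationary_chain P (flip_rate (1 / 2)) (Y v)) ->
    (forall v, history (Y v) `[0, +oo[ (A v)) -> forall v, measurable (A v).
  move=> cY hA v; apply: history_measurable (hA v); first exact: cY.
  by move=> t /=; rewrite in_itv/= andbT.
have prod1 (V : finType) : \prod_(v : V) pr setT = 1.
  by rewrite big1// => v _; rewrite proba_setT.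
have capT (V : finType) : \bigcap_(v in [set: V]) setT = [set: T] by exact: bigcapT.
split; split=> [v|A hA]; do 1?exact: cX.
- have mA := m _ _ _ (fun v => cX (Some (inl v))) hA.
  rewrite probaE; last exact: bigcap_measurable_fin.
  rewrite (eq_bigr (fun v => (pr (A v))%:E)); last by move=> v _; rewrite probaE.
  rewrite prodEFin; congr EFin.
  have := @indep_pr3 _ _ X setT A (fun=> setT) HX (@historyT _ _ _ _) hA (fun=>
    @historyT _ _ _ _).
  by rewrite prod1 proba_setT mul1r mulr1 => <-; rewrite setTI capT setIT.
- have mA := m _ _ _ (fun v => cX (Some (inr v))) hA.
  rewrite probaE; last exact: bigcap_measurable_fin.
  rewrite (eq_bigr (fun v => (pr (A v))%:E)); last by move=> v _; rewrite probaE.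
  rewrite prodEFin; congr EFin.
  have := @indep_pr3 _ _ X setT (fun=> setT) A HX (@historyT _ _ _ _) (fun=>
    @historyT _ _ _ _) hA.
  by rewrite prod1 proba_setT !mul1r => <-; rewrite setTI capT setTI.
Qed.

Section Grid.
Variables (ts : nat -> R) (K : nat).
Hypothesis ts0 : 0 <= ts 0.
Hypothesis tsS : forall i, ts i <= ts i.+1.

Local Notation gtraj Y := (traj Y ts K).

Lemma times_ge0 i : 0 <= ts i.
Proof. by elim: i => // i IH; exact: le_trans (tsS i). Qed.

Lemma history_traj (X : R -> T -> bool) a :
  history X `[0, +oo[ (gtraj X @^-1` [set a]).
Proof.
rewrite traj_preimage; apply: (@history_fdd _ _ _ _ _ (fun i => a (inord i))) => i _ /=.
by rewrite in_itv/= andbT times_ge0.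
Qed.

Lemma fin_measurable_traj (X : R -> T -> bool) :
  (forall t b, 0 <= t -> measurable (X t @^-1` [set b])) -> fin_measurable (gtraj X).
Proof.
move=> mX a; rewrite traj_preimage.
suff gen (b : nat -> bool) k : measurable [set w | forall i, (i < k)%N -> X (ts i) w = b i].
  exact: (gen (fun i => a (inord i))).
elim: k => [|k IH].
  rewrite [X in measurable X](_ : _ = setT)//.
  by apply/seteqP; split.
rewrite [X in measurable X](_ : _ =
    [set w | forall i, (i < k)%N -> X (ts i) w = b i] `&`
    X (ts k) @^-1` [set b k]).
  by apply: measurableI => //; apply: mX; exact: times_ge0.
apply/seteqP; split => w /=.
  by move=> H; split; [move=> i iK; apply: H; exact: ltnW|exact: H].
by move=> [H HK] i; rewrite ltnS leq_eqVlt => /predU1P[->//|/H].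
Qed.

Definition joint_path (V : finType) (X : V -> R -> T -> bool) (w : T) :
  {ffun V -> {ffun 'I_K.+1 -> bool}} := [ffun v => gtraj (X v) w].

Definition output_path n (x : {ffun vertex n -> {ffun 'I_K.+1 -> bool}}) :
  {ffun 'I_K.+1 -> bool} := [ffun i => andor (fun v => x v i)].

Lemma joint_path_preimage (V : finType) (X : V -> R -> T -> bool) x :
  joint_path X @^-1` [set x] = \bigcap_v (gtraj (X v) @^-1` [set x v]).
Proof.
apply/seteqP; split => w /=.
  by move=> <- v _ /=; rewrite ffunE.
by move=> H; apply/ffunP => v; rewrite ffunE; exact: H.
Qed.

Lemma fin_measurable_joint_path (V : finType) (X : V -> R -> T -> bool) : GD X ->
  fin_measurable (joint_path X).
Proof.
move=> [HX _] x; rewrite joint_path_preimage; apply: bigcap_measurable_fin => v.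
by apply: fin_measurable_traj => t b t0; exact: (chain_measurable (HX v)).
Qed.

Lemma traj_output n (X : vertex n -> R -> T -> bool) :
  gtraj (output (@andor n) X) = @output_path n \o joint_path X.
Proof.
apply/funext => w; apply/ffunP => i /=; rewrite !ffunE /output.
by congr andor; apply/funext => v; rewrite !ffunE.
Qed.

Lemma fin_measurable_output n (X : vertex n -> R -> T -> bool) : GD X ->
  fin_measurable (gtraj (output (@andor n) X)).
Proof.
by move=> HX; rewrite traj_output; apply: fin_measurable_comp; exact: fin_measurable_joint_path.
Qed.

Section Node.
Variables (n : nat) (X : vertex n.+1 -> R -> T -> bool).
Hypothesis HX : GD X.
Let XL v := X (Some (inl v)).
Let XR v := X (Some (inr v)).
Let S := gtraj (X None).
Let L := gtraj (output (@andor n) XL).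
Let V := gtraj (output (@andor n) XR).

Lemma fin_measurable_root : fin_measurable S.
Proof. by apply: fin_measurable_traj => t b t0; exact: (chain_measurable (HX.1 None)). Qed.

(** Independence concerns gates, so the product form is first proved for the root path together with
    all gate paths of each subtree, and then pushed forward along [output_path]. *)
Lemma node_indep :
  fin_measurable (fun w => (S w, L w, V w)) /\
  dist (fun w => (S w, L w, V w)) =1 prod3 (dist S) (dist L) (dist V).
Proof.
have [HL HR] := gate_dynamics_subtrees HX.
have mS := fin_measurable_root.
have mJL := fin_measurable_joint_path HL; have mJR := fin_measurable_joint_path HR.
pose Z w := (S w, joint_path XL w, joint_path XR w).
have ZE s x y : Z @^-1` [set (s, x, y)] =
    S @^-1` [set s] `&` (joint_path XL @^-1` [set x] `&` joint_path XR @^-1` [set y]).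
  by apply/seteqP; split => w; rewrite /Z/=; [case=> <- <- <-|case=> <- [<- <-]].
have mZ : fin_measurable Z.
  move=> [[s x] y]; rewrite ZE; apply: measurableI; first exact: mS.
  by apply: measurableI; [exact: mJL|exact: mJR].
have dJ (U : finType) (Y : U -> R -> T -> bool) x : GD Y ->
    dist (joint_path Y) x = \prod_v pr (gtraj (Y v) @^-1` [set x v]).
  by move=> HY; rewrite /pmf joint_path_preimage (indep_pr HY)// => v; exact: history_traj.
have dZ : dist Z =1 prod3 (dist S) (dist (joint_path XL)) (dist (joint_path XR)).
  move=> [[s x] y]; rewrite /prod3/= !dJ// /pmf ZE !joint_path_preimage (indep_pr3 HX)//.
  - by rewrite mulrA.
  - exact: history_traj.
  - by move=> v; exact: history_traj.
  - by move=> v; exact: history_traj.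
have LE : L = @output_path n \o joint_path XL by exact: traj_output.
have VE : V = @output_path n \o joint_path XR by exact: traj_output.
split.
  rewrite (_ : (fun w => _) = (fun z => (z.1.1, output_path z.1.2, output_path z.2)) \o Z).
    exact: fin_measurable_comp.
  by rewrite LE VE.
have := pmf_prod3_comp id (@output_path n) (@output_path n) mS mJL mJR mZ dZ.
by rewrite LE VE.
Qed.

(** Every one-level recursion below comes from this identity: the integrand is compared with a
    combination of [tensor3] terms, whose expectations factor. *)
Lemma Ex_node f :
  Ex (dist (gtraj (output (@andor n.+1) X))) f =
  Ex (prod3 (dist S) (dist L) (dist V)) (fun x => f (gate_path x)).
Proof.
have [m e] := node_indep.
have -> : gtraj (output (@andor n.+1) X) = @gate_path K \o (fun w => (S w, L w, V w)).
  by apply/funext => w; apply/ffunP => i; rewrite !ffunE.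
by rewrite Ex_comp//; apply: eq_bigr => x _; rewrite e.
Qed.

End Node.

Lemma pmf_chain (X : R -> T -> bool) : stationary_chain P (flip_rate (1 / 2)) X ->
  dist (gtraj X) =1 chain_weight ts K.
Proof.
move=> HX a; rewrite /pmf traj_preimage.
exact: (chain_fdd HX (fun i => a (inord i)) K ts0 tsS).
Qed.

Lemma pmf_output n (X : vertex n -> R -> T -> bool) : GD X ->
  dist (gtraj (output (@andor n) X)) =1 law (chain_weight ts K) n.
Proof.
elim: n X => [|n IH] X HX a.
  (* The in-signals 0 and 1 of a leaf make it output its own state. *)
  rewrite /= -(pmf_chain (HX.1 tt)); congr (pmf _ (traj _ _ _) _).
  by apply/funext => t; apply/funext => w; rewrite /output/= /gate; case: (X tt t w).
have [HL HR] := gate_dynamics_subtrees HX.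
have -> : dist (gtraj (output (@andor n.+1) X)) a =
    Ex (dist (gtraj (output (@andor n.+1) X))) (fun c => (c == a)%:R).
  rewrite -(proba_fin_event P (fin_measurable_output HX) (pred1 a)); congr proba.
  by apply/seteqP; split => w /= => [->|/eqP].
rewrite Ex_node//; apply: eq_bigr => -[[s b] c] _; congr (_ * _).
by rewrite /prod3/= (pmf_chain (HX.1 None)) (IH _ HL) (IH _ HR).
Qed.

End Grid.

Lemma output_shift n (X X' : vertex n -> R -> T -> bool) ts c K (E : pred _) :
  GD X -> GD X' -> 0 <= ts 0 -> 0 <= ts 0 + c -> (forall i, ts i <= ts i.+1) ->
  pr [set w | E (traj (output (@andor n) X) ts K w)] =
  pr [set w | E (traj (output (@andor n) X') (fun i => ts i + c) K w)].
Proof.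
move=> HX HX' ts0 tsc0 tsS.
have tsS' i : ts i + c <= ts i.+1 + c by rewrite lerD2r.
rewrite !proba_fin_event; [|exact: fin_measurable_output|exact: fin_measurable_output].
by apply: eq_bigr => a _; rewrite !pmf_output// chain_weight_shift.
Qed.

End Dynamics.

(** * Constant windows *)

Lemma exprn_ge_bernoulli (R : realType) (x : R) n : 0 <= x <= 1 -> 1 - n%:R * x <= (1 - x) ^+ n.
Proof.
move=> /andP[x0 x1]; elim: n => [|n IH]; first by rewrite expr0; lra.
rewrite exprS -natr1; have := ler0n R n.
have : 0 <= 1 - x by lra.
move=> y0 n0; have := ler_wpM2l y0 IH; nra.
Qed.

Section ConstantWindows.
Context {R : realType} {d : measure_display} {T : measurableType d}.
Variables (P : probability T R).
Local Notation pr := (proba P).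
Local Notation dist := (pmf P).
Local Notation GD := (gate_dynamics P (1 / 2)).
Local Notation out n X := (output (@andor n) X).

Definition grid (t0 h : R) (i : nat) : R := t0 + i%:R * h.

Lemma grid_le t0 h i : 0 <= h -> grid t0 h i <= grid t0 h i.+1.
Proof. by move=> h0; rewrite /grid -natr1; lra. Qed.

Lemma grid0 t0 h : grid t0 h 0 = t0.
Proof. by rewrite /grid mul0r addr0. Qed.

Definition const_prob (Y : R -> T -> bool) (b : bool) t0 h N : R :=
  pr [set w | forall i, (i <= N)%N -> Y (grid t0 h i) w = b].

Lemma traj_all (Y : R -> T -> bool) (Q : pred nat) ts K b :
  [set w | [forall (i : 'I_K.+1 | Q i), traj Y ts K w i == b]] =
  [set w | forall i, (i <= K)%N -> Q i -> Y (ts i) w = b].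
Proof.
apply/seteqP; split => w /=.
  move=> /forall_inP H i iK Qi.
  by have := H (Ordinal (iK : (i < K.+1)%N)) Qi; rewrite ffunE => /eqP.
by move=> H; apply/forall_inP => i Qi; rewrite ffunE; apply/eqP/H => //; rewrite -ltnS.
Qed.

Lemma const_prob_shift n (X X' : vertex n -> R -> T -> bool) b (t0 t1 h : R) N :
  GD X -> GD X' -> 0 <= t0 -> 0 <= t1 -> 0 <= h ->
  const_prob (out n X) b t0 h N = const_prob (out n X') b t1 h N.
Proof.
move=> HX HX' t00 t10 h0.
have := @output_shift _ _ _ P n X X' (grid t0 h) (t1 - t0) N
  (fun a => [forall (i | xpredT i), a i == b]) HX HX'.
rewrite grid0 !(traj_all _ xpredT) => /(_ t00); rewrite addrC subrK => /(_ t10).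
move=> /(_ (fun i => grid_le t0 i h0)); rewrite /const_prob => e.
transitivity (pr [set w | forall i, (i <= N)%N -> xpredT i -> out n X (grid t0 h i) w = b]).
  by congr proba; apply/seteqP; split => w /= H i iN; [move=> _|]; exact: H.
rewrite e; congr proba; apply/seteqP; split => w /= H i iN.
  by rewrite -(H i iN)// /grid; congr (output _ _ _ _); ring.
by move=> _; rewrite -(H i iN)// /grid; congr (output _ _ _ _); ring.
Qed.

Lemma const_prob_chain (X : R -> T -> bool) b t0 h N :
  stationary_chain P (flip_rate (1 / 2)) X -> 0 <= t0 -> 0 <= h ->
  const_prob X b t0 h N = 1 / 2 * (1 - flip_prob h) ^+ N.
Proof.
move=> HX t00 h0; rewrite /const_prob.
rewrite (chain_fdd HX (fun=> b) (ts := grid t0 h))//; first last.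
- by move=> i; exact: grid_le.
- by rewrite grid0.
congr (_ * _); rewrite -[X in _ ^+ X](card_ord N) -prodr_const.
apply: eq_bigr => i _; rewrite /transition eqxx /grid -natr1; congr (1 - flip_prob _); ring.
Qed.

Section Step.
Variables (n : nat) (X : vertex n.+1 -> R -> T -> bool).
Hypothesis HX : GD X.
Let XL v := X (Some (inl v)).

(** Put [Q = (1 - flip_prob h)^N]. A root staying at [b] has weight [Q / 2] and contributes
    [2 a - a^2] when some child is constantly [b], plus [2 (al - a)^2] when neither is but the
    children cover complementary pieces, in two ways. A root staying at [~~ b] contributes [a^2],
    which cancels the overlap. The bound [N <= 2 N1 + 1] says that the first and last [N1 + 1] of
    the [N + 1] grid points cover the grid. *)
Lemma const_prob_step b (t0 h : R) N N1 : (N1 <= N <= N1.*2.+1)%N -> 0 <= t0 -> 0 <= h ->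
  (1 - flip_prob h) ^+ N *
    (const_prob (out n XL) b t0 h N +
      (const_prob (out n XL) b t0 h N1 - const_prob (out n XL) b t0 h N) ^+ 2) <=
  const_prob (out n.+1 X) b t0 h N.
Proof.
move=> /andP[N1N NN1] t00 h0; set a := const_prob (out n XL) b t0 h N; set al :=
  const_prob (out n XL) b t0 h N1.
have [HL HR] := gate_dynamics_subtrees HX.
pose XR v := X (Some (inr v)).
have ts0 : 0 <= grid t0 h 0 by rewrite grid0.
have tsS i : grid t0 h i <= grid t0 h i.+1 by exact: grid_le.
pose al_on (Q : pred nat) (c : bool) (p : {ffun 'I_N.+1 -> bool}) : bool :=
  [forall (i : 'I_N.+1 | Q i), p i == c].
have ExE n' (Y : vertex n' -> R -> T -> bool) Q c : GD Y ->
    Ex (dist (traj (out n' Y) (grid t0 h) N)) (fun p => (al_on Q c p)%:R) =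
    pr [set w | forall i, (i <= N)%N -> Q i -> out n' Y (grid t0 h i) w = c].
  move=> HY; rewrite -traj_all -(proba_fin_event P _ (al_on Q c))//.
  exact: (fin_measurable_output ts0 tsS HY).
pose Q1 i := (i <= N1)%N; pose Q2 i := (N - N1 <= i)%N.
have eT (Y : vertex n -> R -> T -> bool) : GD Y ->
    Ex (dist (traj (out n Y) (grid t0 h) N)) (fun p => (al_on xpredT b p)%:R) = a.
  move=> HY; rewrite ExE// /a (const_prob_shift b N HL HY t00 t00 h0); congr proba.
  by apply/seteqP; split => w /= H i iN; [|move=> _]; exact: H.
have e1 (Y : vertex n -> R -> T -> bool) : GD Y ->
    Ex (dist (traj (out n Y) (grid t0 h) N)) (fun p => (al_on Q1 b p)%:R) = al.
  move=> HY; rewrite ExE// /al (const_prob_shift b N1 HL HY t00 t00 h0); congr proba.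
  apply/seteqP; split => w /= H i iN; last exact: H.
  by apply: H => //; exact: leq_trans N1N.
(* The final piece is a translate of the initial one, so it has the same probability. *)
have e2 (Y : vertex n -> R -> T -> bool) : GD Y ->
    Ex (dist (traj (out n Y) (grid t0 h) N)) (fun p => (al_on Q2 b p)%:R) = al.
  move=> HY; have t10 : 0 <= grid t0 h (N - N1) by rewrite /grid addr_ge0// mulr_ge0.
  rewrite ExE// /al (const_prob_shift b N1 HL HY t00 t10 h0); congr proba.
  have gE i : grid (grid t0 h (N - N1)) h i = grid t0 h (N - N1 + i).
    by rewrite /grid natrD; ring.
  apply/seteqP; split => w /= H i iN.
    by rewrite gE; apply: H; rewrite /Q2; lia.
  by rewrite /Q2 => Ni; rewrite -(subnKC Ni) -gE; apply: H; lia.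
have eS c : Ex (dist (traj (X None) (grid t0 h) N)) (fun p => (al_on xpredT c p)%:R) =
    1 / 2 * (1 - flip_prob h) ^+ N.
  rewrite -(const_prob_chain c N (HX.1 None) t00 h0) -(proba_fin_event P _ (al_on xpredT c)).
    rewrite traj_all; congr proba.
    by apply/seteqP; split => w /= H i iN; [|move=> _]; exact: H.
  exact: (fin_measurable_root ts0 tsS HX).
have -> : const_prob (out n.+1 X) b t0 h N =
  pr [set w | al_on xpredT b (traj (out n.+1 X) (grid t0 h) N w)].
  rewrite traj_all; congr proba.
  by apply/seteqP; split => w /= H i iN; [move=> _|]; exact: H.
rewrite proba_fin_event; last exact: (fin_measurable_output ts0 tsS HX).
rewrite Ex_node//.
pose A Q c p : R := (al_on Q c p)%:R.
pose one (p : {ffun 'I_N.+1 -> bool}) : R := 1.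
pose AB Q p : R := A Q b p - A xpredT b p.
pose rhs x := tensor3 (A xpredT b) (A xpredT b) one x + tensor3 (A xpredT b) one (A xpredT b) x
  - tensor3 (A xpredT b) (A xpredT b) (A xpredT b) x + tensor3 (A xpredT b) (AB Q1) (AB Q2) x
  + tensor3 (A xpredT b) (AB Q2) (AB Q1) x +
    tensor3 (A xpredT (~~ b)) (A xpredT b) (A xpredT b) x.
apply: (@le_trans _ _ (Ex (prod3 (dist (traj (X None) (grid t0 h) N))
    (dist (traj (out n XL) (grid t0 h) N)) (dist (traj (out n XR) (grid t0 h) N))) rhs)).
  rewrite /rhs !ExD ExN !Ex_tensor3 /AB !ExB /A !eS !eT// !e1// !e2// /one.
  rewrite !Ex_cst; 
    [|exact: (fin_measurable_output ts0 tsS HL)|exact: (fin_measurable_output ts0 tsS HR)].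
  by rewrite le_eqVlt; apply/orP; left; apply/eqP; field.
apply: Ex_le => [x|[[s p] q]].
  by rewrite /prod3 !mulr_ge0// pmf_ge0.
rewrite /rhs /tensor3 /AB /A /one /=.
have sub Q p' : al_on xpredT b p' -> al_on Q b p'.
  by move=> /forall_inP H; apply/forall_inP => i _; exact: H.
have cov p' : al_on Q1 b p' -> al_on Q2 b p' -> al_on xpredT b p'.
  move=> /forall_inP H1 /forall_inP H2; apply/forall_inP => i _.
  have [iN1|iN1] := leqP i N1; [exact: H1|apply: H2; rewrite /Q2; lia].
(* Constancy on the whole grid is the conjunction of constancy on the two pieces, so a child shows
   only four truth patterns. *)
pose shape c c1 c2 := [\/ [/\ c = true, c1 = true & c2 = true],
  [/\ c = false, c1 = true & c2 = false], [/\ c = false, c1 = false & c2 = true]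
  | [/\ c = false, c1 = false & c2 = false]].
have shapeP p' : shape (al_on xpredT b p') (al_on Q1 b p') (al_on Q2 b p').
  move: (sub Q1 p') (sub Q2 p') (cov p'); rewrite /shape.
  case: (al_on xpredT b p') => [/(_ isT) -> /(_ isT) ->|_ _]; first by constructor 1.
  case: (al_on Q1 b p') => [/(_ isT)|_].
    by case: (al_on Q2 b p') => [/(_ isT)//|_]; constructor 2.
  by case: (al_on Q2 b p'); [constructor 3|constructor 4].
have gb c x y : gate c x y = c <-> (x == c) || (y == c) by case: c x y => -[] [].
have gnb c x y : gate (~~ c) x y = c <-> (x == c) && (y == c) by case: c x y => -[] [].
have nn : al_on xpredT b s -> ~~ al_on xpredT (~~ b) s.
  move=> /forall_inP/(_ ord0 isT)/eqP s0; apply/negP => /forall_inP/(_ ord0 isT).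
  by rewrite s0; case: (b).
have g1 : al_on xpredT b s ->
    [|| al_on xpredT b p, al_on xpredT b q, al_on Q1 b p && al_on Q2 b q
      | al_on Q2 b p && al_on Q1 b q] -> al_on xpredT b (gate_path (s, p, q)).
  move=> /forall_inP Hs Hpq; apply/forall_inP => i _; rewrite ffunE/=.
  rewrite (eqP (Hs i isT)); apply/eqP/gb.
  case/or4P: Hpq => [/forall_inP H|/forall_inP H|/andP[/forall_inP H1 /forall_inP H2]
    |/andP[/forall_inP H2 /forall_inP H1]].
  - by rewrite H.
  - by rewrite H ?orbT.
  - have [iN1|iN1] := leqP i N1; first by rewrite H1.
    by rewrite H2 ?orbT// /Q2; lia.
  - have [iN1|iN1] := leqP i N1; first by rewrite H1 ?orbT.
    by rewrite H2// /Q2; lia.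
have g2 : al_on xpredT (~~ b) s -> al_on xpredT b p && al_on xpredT b q ->
    al_on xpredT b (gate_path (s, p, q)).
  move=> /forall_inP Hs /andP[/forall_inP Hp /forall_inP Hq]; apply/forall_inP => i _.
  by rewrite ffunE/= (eqP (Hs i isT)); apply/eqP/gnb; rewrite Hp// Hq.
case: (al_on xpredT b s) nn g1 => [/(_ isT)/negPf -> /(_ isT)|_ _].
  case: (shapeP p) => -[-> -> ->]; case: (shapeP q) => -[-> -> ->] /=;
  case: (al_on xpredT b (gate_path (s, p, q))) => /= g1; try (by have := g1 isT); lra.
case: (al_on xpredT (~~ b) s) g2 => [/(_ isT)|_].
  case: (al_on xpredT b p); case: (al_on xpredT b q) => /=;
  case: (al_on xpredT b (gate_path (s, p, q))) => /= g2; try (by have := g2 isT); lra.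
by rewrite !(mul0r, mulr0, mul1r, mulr1, add0r, addr0, subr0).
Qed.

End Step.
End ConstantWindows.

(** * Lower bounds for constancy, uniform in the depth *)

Section ConstantBounds.
Context {R : realType} {d : measure_display} {T : measurableType d}.
Variables (P : probability T R).
Local Notation pr := (proba P).
Local Notation dist := (pmf P).
Local Notation GD := (gate_dynamics P (1 / 2)).
Local Notation out n X := (output (@andor n) X).
Local Notation cst := (const_prob P).

Lemma measurable_output n (X : vertex n -> R -> T -> bool) t b : GD X -> 0 <= t ->
  measurable (out n X t @^-1` [set b]).
Proof.
move=> HX t0.
have := @fin_measurable_output _ _ _ P (fun=> t) 0 t0 (fun=> lexx _) n X HX [ffun=> b].
rewrite traj_preimage; congr (measurable _); apply/seteqP; split => w /=.
  by move/(_ 0 isT) => ->; rewrite ffunE.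
by move=> H i _; rewrite ffunE.
Qed.

Lemma measurable_window n (X : vertex n -> R -> T -> bool) b t0 h N :
  GD X -> 0 <= t0 -> 0 <= h ->
  measurable [set w | forall i, (i <= N)%N -> out n X (grid t0 h i) w = b].
Proof.
move=> HX t00 h0.
have ts0 : 0 <= grid t0 h 0 by rewrite grid0.
have := measurable_fin_event (fin_measurable_output ts0 (fun i => grid_le t0 i h0) HX)
  (fun a => [forall (i : 'I_N.+1 | xpredT i), a i == b]).
rewrite (traj_all _ xpredT); congr (measurable _).
by apply/seteqP; split => w /= H i iN; [|move=> _]; exact: H.
Qed.

Lemma output_leaf (X : vertex 0 -> R -> T -> bool) : out 0 X = X tt.
Proof.
by apply/funext => t; apply/funext => w; rewrite /output/= /gate; case: (X tt t w).
Qed.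

(** 1/2 is a fixed point of the one-time recursion: a root in state [b] gives [1 - 1/4], one in
    state [~~ b] gives [1/4], and each has weight 1/2. *)
Lemma output_marginal n (X : vertex n -> R -> T -> bool) t b : GD X -> 0 <= t ->
  pr (out n X t @^-1` [set b]) = 1 / 2.
Proof.
move=> + t0; elim: n X b => [|n IH] X b HX.
  by rewrite output_leaf (chain_marginal (HX.1 tt)).
have tsS (i : nat) : t <= t := lexx _.
have [HL HR] := gate_dynamics_subtrees HX.
pose ts (i : nat) := t.
pose val0 c (a : {ffun 'I_1 -> bool}) : R := (a ord0 == c)%:R.
have ExE (Y : R -> T -> bool) c : fin_measurable (traj Y ts 0) ->
    Ex (dist (traj Y ts 0)) (val0 c) = pr (Y t @^-1` [set c]).
  move=> mY; rewrite -(proba_fin_event P mY (fun a => a ord0 == c)); congr proba.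
  by apply/seteqP; split => w /=; rewrite ffunE; [move/eqP|move=> ->].
have mS := @fin_measurable_root _ _ _ P ts 0 t0 tsS n X HX.
have mL := @fin_measurable_output _ _ _ P ts 0 t0 tsS n _ HL.
have mV := @fin_measurable_output _ _ _ P ts 0 t0 tsS n _ HR.
rewrite -ExE; last exact: (@fin_measurable_output _ _ _ P ts 0 t0 tsS n.+1).
rewrite (@Ex_node _ _ _ P ts 0 t0 tsS n X HX).
pose one (p : {ffun 'I_1 -> bool}) : R := 1.
rewrite (eq_Ex _ (g := fun x => tensor3 (val0 b) (val0 b) one x + tensor3 (val0 b) one (val0 b) x
  - tensor3 (val0 b) (val0 b) (val0 b) x + tensor3 (val0 (~~ b)) (val0 b) (val0 b) x));
    last first.
  move=> [[s p] q]; rewrite /tensor3 /val0 /one ffunE /=.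
  by case: (s ord0) (p ord0) (q ord0) (b) => -[] [] [] /=; ring.
rewrite !ExD ExN !Ex_tensor3 !ExE// !IH// !(chain_marginal (HX.1 None))// /one !Ex_cst//.
by field.
Qed.

Lemma const_prob0 n (X : vertex n -> R -> T -> bool) b t0 h : GD X -> 0 <= t0 ->
  cst (out n X) b t0 h 0 = 1 / 2.
Proof.
move=> HX t00; rewrite -(output_marginal b HX t00); congr proba.
apply/seteqP; split => w /=; first by move/(_ 0 isT); rewrite grid0.
by move=> H i; rewrite leqn0 => /eqP ->; rewrite grid0.
Qed.

Lemma flip_prob_pow_ge (h : R) N : 0 <= h -> 1 - N%:R * h / 2 <= (1 - flip_prob h) ^+ N.
Proof.
move=> h0; have l0 := flip_prob_ge0 h0; have l1 := flip_prob_lt_half h; have l2 := flip_prob_le h.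
have l01 : 0 <= flip_prob h <= 1 by lra.
apply: le_trans (exprn_ge_bernoulli N l01); rewrite -mulrA lerB// ler_wpM2l//.
Qed.

Lemma const_prob_ge0 Y b t0 h N : 0 <= cst Y b t0 h N.
Proof. exact: proba_ge0. Qed.

(** Here [u] and [u1] are the square roots of the lengths of the window and its half. The lower
    bounds differ by at least [3 u - 9 u / 4 = 3 u / 4]. If [a] exceeds its own lower bound by [e],
    then either [e] is small and the square still gains enough, or [e] alone exceeds the gain
    [9 u^2 / 16]; the factor [Q] costs only about [u^2 / 4]. *)
Lemma quadratic_step (a al u u1 Q a' : R) : 0 <= u <= 1 / 6 -> 0 <= u1 <= 3 / 4 * u ->
  1 / 2 - 3 * u <= a -> 1 / 2 - 3 * u1 <= al -> 1 - u ^+ 2 / 2 <= Q ->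
  Q * (a + (al - a) ^+ 2) <= a' -> 1 / 2 - 3 * u <= a'.
Proof.
move=> hu hu1 ha hal hQ; apply: le_trans.
have m : 1 / 2 - 3 * u + 9 / 16 * u ^+ 2 <= a + (al - a) ^+ 2.
  set e := a - (1 / 2 - 3 * u); have aE : a = 1 / 2 - 3 * u + e by rewrite /e; ring.
  have e0 : 0 <= e by lra.
  have [ge|lt] := leP e (3 / 4 * u).
    have h1 : 3 / 4 * u - e <= al - a by lra.
    have h2 : (3 / 4 * u - e) ^+ 2 <= (al - a) ^+ 2.
      by rewrite ler_sqr// ?nnegrE; lra.
    nra.
  have := sqr_ge0 (al - a); nra.
have Q0 : 0 <= 1 - u ^+ 2 / 2 by nra.
have m0 : 0 <= 1 / 2 - 3 * u + 9 / 16 * u ^+ 2 by nra.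
apply: (@le_trans _ _ ((1 - u ^+ 2 / 2) * (1 / 2 - 3 * u + 9 / 16 * u ^+ 2))).
  have u2 : u ^+ 2 <= 1 / 36 by nra.
  have : 0 <= u ^+ 2 by exact: sqr_ge0.
  have : 0 <= u ^+ 3 by rewrite exprn_ge0; lra.
  rewrite !expr2 exprS expr2; nra.
by rewrite ler_pM.
Qed.

(** Induction on the depth with [k] general, since the step at [k] uses the children at [k] and at
    [k - 1]. Halving the window multiplies [u] by [1 / sqrt 2 <= 3/4]; for [u > 1/6] the bound is
    negative. *)
Lemma const_prob_ge n (X : vertex n -> R -> T -> bool) b t0 h k :
  GD X -> 0 <= t0 -> 0 <= h ->
  1 / 2 - 3 * Num.sqrt (2 ^+ k * h) <= cst (out n X) b t0 h (2 ^ k).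
Proof.
elim: n X t0 k => [|n IH] X t0 k HX t00 h0; set u := Num.sqrt _;
  have u0 : 0 <= u := sqrtr_ge0 _;
  have uE : u ^+ 2 = (2 ^ k)%:R * h by rewrite sqr_sqrtr ?mulr_ge0 ?natrX// exprn_ge0.
  rewrite output_leaf (const_prob_chain _ _ (HX.1 tt))//.
  have := flip_prob_pow_ge (2 ^ k) h0; have l0 := flip_prob_lt_half h.
  have : 0 <= (1 - flip_prob h) ^+ (2 ^ k) by rewrite exprn_ge0//; lra.
  rewrite -uE; have [u6|u6] := leP u (1 / 6); nra.
have [u6|u6] := leP u (1 / 6); last first.
  by apply: le_trans (const_prob_ge0 _ _ _ _ _); lra.
have [HL HR] := gate_dynamics_subtrees HX.
have hQ : 1 - u ^+ 2 / 2 <= (1 - flip_prob h) ^+ (2 ^ k).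
  by rewrite uE; exact: flip_prob_pow_ge.
have ha := IH _ t0 k HL t00 h0.
(* For a window of one step the half window is a single point, with constancy probability exactly
   1/2, so [u1 = 0]. *)
case: k => [|k] in u u0 uE u6 hQ ha *.
  have := @const_prob_step _ _ _ P n X HX b t0 h 1 0 isT t00 h0.
  rewrite (const_prob0 b h HL t00); apply: (@quadratic_step _ _ _ 0); rewrite ?u0//; try lra.
have NN : (2 ^ k <= 2 ^ k.+1 <= (2 ^ k).*2.+1)%N by rewrite expnS mul2n; lia.
have := @const_prob_step _ _ _ P n X HX b t0 h _ _ NN t00 h0.
apply: (@quadratic_step _ _ _ (Num.sqrt (2 ^+ k * h))); rewrite ?u0 ?sqrtr_ge0//=.
  rewrite -(ler_sqr (sqrtr_ge0 _)) ?nnegrE ?mulr_ge0// exprMn uE.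
  rewrite sqr_sqrtr ?mulr_ge0 ?exprn_ge0// natrX [2 ^+ k.+1]exprS.
  have : 0 <= 2 ^+ k * h by rewrite mulr_ge0// exprn_ge0.
  nra.
exact: IH.
Qed.

(** The start [1/4 = 1/2 - 3/12] is the bound for length at most [1/144]. A doubling squares it; one
    factor 1/2 is the survival of the root, the other the loss in passing from [a + (al - a)^2] to
    [al^2 / 2]. *)
Fixpoint floor_const (i : nat) : R := if i is j.+1 then floor_const j ^+ 2 / 4 else 1 / 4.

Lemma floor_const_gt0 i : 0 < floor_const i <= 1 / 4.
Proof. by elim: i => [|i /= IH]; [rewrite /=; lra|nra]. Qed.

(** Each doubling of the window consumes one level of the tree. If the levels run out, a single gate
    is constant with probability at least 1/4, which is enough. *)
Lemma const_prob_doubling n (X : vertex n -> R -> T -> bool) b t0 h k i :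
  GD X -> 0 <= t0 -> 0 <= h -> 2 ^+ k * h <= 1 / 144 -> 2 ^+ (k + i) * h <= 1 ->
  floor_const i <= cst (out n X) b t0 h (2 ^ (k + i)).
Proof.
move=> + + h0 hk.
have q4 N : N%:R * h <= 1 -> 1 / 2 <= (1 - flip_prob h) ^+ N.
  by move=> Nh; apply: le_trans (flip_prob_pow_ge N h0); lra.
elim: i n X t0 => [|i IH] n X t0 HX t00 hki.
  rewrite addn0; apply: le_trans (const_prob_ge b k HX t00 h0).
  have : Num.sqrt (2 ^+ k * h) <= 1 / 12.
    rewrite -[leRHS]ger0_norm// -sqrtr_sqr ler_wsqrtr//; nra.
  rewrite /=; lra.
have f0 := floor_const_gt0 i; have f1 := floor_const_gt0 i.+1.
have hQ : 1 / 2 <= (1 - flip_prob h) ^+ (2 ^ (k + i.+1)) by apply: q4; rewrite natrX.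
case: n X HX => [|n] X HX.
  rewrite output_leaf (const_prob_chain _ _ (HX.1 tt))//; lra.
have [HL HR] := gate_dynamics_subtrees HX.
have NN : (2 ^ (k + i) <= 2 ^ (k + i.+1) <= (2 ^ (k + i)).*2.+1)%N.
  by rewrite addnS expnS mul2n; lia.
apply: le_trans (@const_prob_step _ _ _ P n X HX b t0 h _ _ NN t00 h0).
have hki' : 2 ^+ (k + i) * h <= 1.
  apply: le_trans hki; rewrite ler_wpM2r// addnS exprS.
  by rewrite ler_peMl// ?ler1n// exprn_ge0.
have := IH n _ t0 HL t00 hki'.
set a := cst _ _ _ _ (2 ^ (k + i.+1)); set al := cst _ _ _ _ _ => hal.
have a0 : 0 <= a := const_prob_ge0 _ _ _ _ _.
have a1 : a <= 1 / 2.
  rewrite -(output_marginal b HL t00); apply: le_proba.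
  - exact: measurable_window.
  - exact: measurable_output.
  - by move=> w /(_ 0 isT); rewrite grid0.
rewrite /=; set Q := _ ^+ (2 ^ _) in hQ *.
have : floor_const i ^+ 2 <= al ^+ 2 by rewrite ler_sqr ?nnegrE//; lra.
(* [2 (a + (al - a)^2) - al^2 = (al - 2 a)^2 + 2 a (1 - a)]. *)
have s0 := sqr_ge0 (al - 2 * a); have s1 := sqr_ge0 (al - a).
have : al ^+ 2 <= 2 * (a + (al - a) ^+ 2) by nra.
nra.
Qed.

End ConstantBounds.

(** * Changes at given times *)

(** A gate in state [s] transmits one child exactly when the other has the neutral value [~~ s]. The
    terms sort the sources of the two changes: different children, the root twice, the root once and
    a child once, or the same child twice. In the last case the other child must be neutral; this is
    recorded only at the inner times 1 and 2, whose distance governs the contraction. *)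
Lemma gate_change_le (s0 s1 s2 s3 a0 a1 a2 a3 c0 c1 c2 c3 : bool) :
  ((gate s0 a0 c0 != gate s1 a1 c1) && (gate s2 a2 c2 != gate s3 a3 c3) <=
   (a0 != a1) * (c2 != c3) + (a2 != a3) * (c0 != c1) +
   ((s0 != s1) && (s2 != s3)) +
   ((s0 != s1) * (a2 != a3) + (s0 != s1) * (c2 != c3)) +
   ((s2 != s3) * (a0 != a1) + (s2 != s3) * (c0 != c1)) +
   (((a0 != a1) && (a2 != a3)) * ((c1 == ~~ s1) && (c2 == ~~ s2)) +
    ((a1 == ~~ s1) && (a2 == ~~ s2)) * ((c0 != c1) && (c2 != c3))))%N.
Proof.
by case: s0 s1 s2 s3 a0 a1 a2 a3 c0 c1 c2 c3 => -[] [] [] [] [] [] [] [] [] [] [].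
Qed.

Section Changes.
Context {R : realType} {d : measure_display} {T : measurableType d}.
Variables (P : probability T R).
Local Notation pr := (proba P).
Local Notation dist := (pmf P).
Local Notation GD := (gate_dynamics P (1 / 2)).
Local Notation out n X := (output (@andor n) X).

Definition change_prob (Y : R -> T -> bool) s t : R := pr [set w | Y s w != Y t w].

Definition joint_change_prob (Y : R -> T -> bool) t0 t1 t2 t3 : R :=
  pr [set w | (Y t0 w != Y t1 w) && (Y t2 w != Y t3 w)].

Lemma measurable_pair (Y : R -> T -> bool) s t (E : bool -> bool -> bool) :
  (forall b, measurable (Y s @^-1` [set b])) ->
  (forall b, measurable (Y t @^-1` [set b])) ->
  measurable [set w | E (Y s w) (Y t w)].
Proof.
move=> ms mt.
apply: (@measurable_fin_event _ _ _ (fun w => (Y s w, Y t w)) _ (fun p => E p.1 p.2)).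
move=> [x y]; rewrite [X in measurable X](_ : _ = Y s @^-1` [set x] `&` Y t @^-1` [set y]).
  exact: measurableI.
by apply/seteqP; split => w /=; [case=> <- <-|case=> <- <-].
Qed.

(** A two-by-two table with uniform margins has a single free parameter, here the probability of
    disagreement. *)
Lemma pair_law (Y : R -> T -> bool) s t x y :
  (forall b, measurable (Y s @^-1` [set b])) ->
  (forall b, measurable (Y t @^-1` [set b])) ->
  (forall b, pr (Y s @^-1` [set b]) = 1 / 2) ->
  (forall b, pr (Y t @^-1` [set b]) = 1 / 2) ->
  pr [set w | (Y s w == x) && (Y t w == y)] =
  if x == y then (1 - change_prob Y s t) / 2 else change_prob Y s t / 2.
Proof.
move=> ms mt es et.
have mE E := @measurable_pair Y s t E ms mt.
pose p x y := pr [set w | (Y s w == x) && (Y t w == y)].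
have mp x' y' : measurable [set w | (Y s w == x') && (Y t w == y')].
  exact: (mE (fun a b => (a == x') && (b == y'))).
have e1 : p true true + p true false = 1 / 2.
  rewrite -(es true) -probaU//; last first.
    by apply/seteqP; split => w //= -[/andP[_ /eqP ->]]; rewrite andbF.
  congr proba; apply/seteqP; split => w /=; first by case=> /andP[/eqP].
  by move=> ->; case: (Y t w); [left|right].
have e2 : p true true + p false true = 1 / 2.
  rewrite -(et true) -probaU//; last first.
    by apply/seteqP; split => w //= -[/andP[/eqP -> _]].
  congr proba; apply/seteqP; split => w /=; first by case=> /andP[_ /eqP].
  by move=> ->; case: (Y s w); [left|right].
have e3 : p true false + p false false = 1 / 2.
  rewrite -(et false) -probaU//; last first.
    by apply/seteqP; split => w //= -[/andP[/eqP -> _]].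
  congr proba; apply/seteqP; split => w /=; first by case=> /andP[_ /eqP].
  by move=> ->; case: (Y s w); [left|right].
have e4 : p true false + p false true = change_prob Y s t.
  rewrite /change_prob -probaU//; last first.
    by apply/seteqP; split => w //= -[/andP[/eqP -> _]].
  congr proba; apply/seteqP; split => w /=; first by case=> /andP[/eqP -> /eqP ->].
  by case: (Y s w) (Y t w) => -[]//= _; [left|right].
by rewrite -/(p x y); case: x y => -[] /=; lra.
Qed.

Lemma chain_change_prob (X : R -> T -> bool) s t : stationary_chain P (flip_rate (1 / 2)) X ->
  0 <= s <= t -> change_prob X s t = flip_prob (t - s).
Proof.
move=> HX /andP[s0 st].
have := @chain_flip _ _ _ P X HX s (t - s) setT s0; rewrite subr_ge0 =>
  /(_ st (@historyT _ _ _ _)).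
by rewrite proba_setT mul1r setTI addrC subrK.
Qed.

Definition times4 (t0 t1 t2 t3 : R) (i : nat) : R :=
  if i is j.+1 then if j is k.+1 then if k is 0%N then t2 else t3 else t1 else t0.

Lemma joint_change_prob_shift n (X X' : vertex n -> R -> T -> bool) t0 t1 t2 t3 c :
  GD X -> GD X' -> 0 <= t0 -> 0 <= t0 + c -> t0 <= t1 <= t2 -> t2 <= t3 ->
  joint_change_prob (out n X) t0 t1 t2 t3 =
    joint_change_prob (out n X') (t0 + c) (t1 + c) (t2 + c) (t3 + c).
Proof.
move=> HX HX' t00 t0c /andP[t01 t12] t23.
have tsS i : times4 t0 t1 t2 t3 i <= times4 t0 t1 t2 t3 i.+1.
  by case: i => [//|[|[|i]]] /=.
have := @output_shift _ _ _ P n X X' _ c 3 (fun a =>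
  (a (inord 0) != a (inord 1)) && (a (inord 2) != a (inord 3))) HX HX' t00 t0c tsS.
rewrite /joint_change_prob => e; transitivity (pr [set w |
    (traj (out n X) (times4 t0 t1 t2 t3) 3 w (inord 0) !=
     traj (out n X) (times4 t0 t1 t2 t3) 3 w (inord 1)) &&
    (traj (out n X) (times4 t0 t1 t2 t3) 3 w (inord 2) !=
     traj (out n X) (times4 t0 t1 t2 t3) 3 w (inord 3))]).
  by congr proba; apply/seteqP; split => w /=; rewrite !ffunE !inordK.
by rewrite e; congr proba; apply/seteqP; split => w /=; rewrite !ffunE !inordK.
Qed.

Lemma change_prob_shift n (X X' : vertex n -> R -> T -> bool) s t c :
  GD X -> GD X' -> 0 <= s -> 0 <= s + c -> s <= t ->
  change_prob (out n X) s t = change_prob (out n X') (s + c) (t + c).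
Proof.
move=> HX HX' s0 sc st.
have tsS i : times4 s t t t i <= times4 s t t t i.+1 by case: i => [//|[|[|i]]] /=.
have := @output_shift _ _ _ P n X X' _ c 3 (fun a =>
  (a (inord 0) != a (inord 1))) HX HX' s0 sc tsS.
rewrite /change_prob => e'; transitivity (pr [set w |
    (traj (out n X) (times4 s t t t) 3 w (inord 0) !=
     traj (out n X) (times4 s t t t) 3 w (inord 1))]).
  by congr proba; apply/seteqP; split => w /=; rewrite !ffunE !inordK.
by rewrite e'; congr proba; apply/seteqP; split => w /=; rewrite !ffunE !inordK.
Qed.

Lemma output_pair_law n (X : vertex n -> R -> T -> bool) s t x y : GD X ->
  0 <= s -> 0 <= t ->
  pr [set w | (out n X s w == x) && (out n X t w == y)] =
  if x == y then (1 - change_prob (out n X) s t) / 2 else change_prob (out n X) s t / 2.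
Proof.
move=> HX s0 t0; apply: pair_law => b; try exact: (measurable_output b HX).
  exact: output_marginal.
exact: output_marginal.
Qed.

Lemma chain_pair_law (X : R -> T -> bool) s t x y :
  stationary_chain P (flip_rate (1 / 2)) X -> 0 <= s <= t ->
  pr [set w | (X s w == x) && (X t w == y)] =
  if x == y then (1 - flip_prob (t - s)) / 2 else flip_prob (t - s) / 2.
Proof.
move=> HX st; have /andP[s0 st'] := st; have t0 := le_trans s0 st'.
rewrite -(chain_change_prob HX st); apply: pair_law => b; try exact: (chain_measurable HX b).
  exact: (chain_marginal HX).
exact: (chain_marginal HX).
Qed.

Section Node.
Variables (n : nat) (X : vertex n.+1 -> R -> T -> bool).
Hypothesis HX : GD X.
Let XL v := X (Some (inl v)).
Let XR v := X (Some (inr v)).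

Section Times.
Variables (t0 t1 t2 t3 : R).
Hypothesis t00 : 0 <= t0.
Hypothesis t012 : t0 <= t1 <= t2.
Hypothesis t23 : t2 <= t3.
Let ts := times4 t0 t1 t2 t3.

Let tsS i : ts i <= ts i.+1.
Proof. by move: t012 => /andP[? ?]; case: i => [//|[|[|i]]] /=. Qed.

Let ge0 i : 0 <= ts i.
Proof. by elim: i => // i IH; exact: le_trans (tsS i). Qed.

Lemma Ex4 (Y : R -> T -> bool) (E : bool -> bool -> bool -> bool -> bool) :
  (forall t b, 0 <= t -> measurable (Y t @^-1` [set b])) ->
  Ex (dist (traj Y ts 3)) (fun a =>
    (E (a (inord 0)) (a (inord 1)) (a (inord 2)) (a (inord 3)))%:R) =
  pr [set w | E (Y t0 w) (Y t1 w) (Y t2 w) (Y t3 w)].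
Proof.
move=> mY; rewrite -(proba_fin_event P _ (fun a : {ffun 'I_4 -> bool} =>
  E (a (inord 0)) (a (inord 1)) (a (inord 2)) (a (inord 3)))); last first.
  exact: fin_measurable_traj.
by congr proba; apply/seteqP; split => w /=; rewrite !ffunE !inordK.
Qed.

Let r := change_prob (out n XL).

(** A child is neutral for the root at both [t1] and [t2] with probability
    [((1 - f)(1 - r) + f r) / 2], where [f] and [r] are the disagreement probabilities of root and
    child. The two children make up for the factor 1/2; what remains is the contraction factor. The
    additive terms are the mixed sources of change. *)
Lemma joint_change_prob_step :
  joint_change_prob (out n.+1 X) t0 t1 t2 t3 <=
  ((1 - flip_prob (t2 - t1)) * (1 - r t1 t2) + flip_prob (t2 - t1) * r t1 t2) *
    joint_change_prob (out n XL) t0 t1 t2 t3 +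
  2 * r t0 t1 * r t2 t3 + flip_prob (t1 - t0) * flip_prob (t3 - t2) +
  2 * flip_prob (t1 - t0) * r t2 t3 + 2 * flip_prob (t3 - t2) * r t0 t1.
Proof.
have [HL HR] := gate_dynamics_subtrees HX.
have /andP[t01 t12] := t012.
have t10 : 0 <= t1 := le_trans t00 t01.
have t20 : 0 <= t2 := le_trans t10 t12.
have t30 : 0 <= t3 := le_trans t20 t23.
have t01' : 0 <= t0 <= t1 by rewrite t00.
have t12' : 0 <= t1 <= t2 by rewrite t10.
have t23' : 0 <= t2 <= t3 by rewrite t20.
pose cI (a : {ffun 'I_4 -> bool}) : R := (a (inord 0) != a (inord 1))%:R.
pose cJ (a : {ffun 'I_4 -> bool}) : R := (a (inord 2) != a (inord 3))%:R.
pose cIJ (a : {ffun 'I_4 -> bool}) : R :=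
  ((a (inord 0) != a (inord 1)) && (a (inord 2) != a (inord 3)))%:R.
pose B x y (a : {ffun 'I_4 -> bool}) : R := ((a (inord 1) == x) && (a (inord 2) == y))%:R.
pose one (a : {ffun 'I_4 -> bool}) : R := 1.
pose S := traj (X None) ts 3.
have mX t b : 0 <= t -> measurable (X None t @^-1` [set b]).
  by move=> t0'; exact: (chain_measurable (HX.1 None)).
have mO m (Z : vertex m -> R -> T -> bool) t b : GD Z -> 0 <= t ->
    measurable (out m Z t @^-1` [set b]).
  by move=> HZ t0'; exact: (measurable_output b HZ).
have eIS : Ex (dist S) cI = flip_prob (t1 - t0).
  by rewrite -(chain_change_prob (HX.1 None) t01') (Ex4 (fun a b _ _ => a != b) mX).
have eJS : Ex (dist S) cJ = flip_prob (t3 - t2).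
  by rewrite -(chain_change_prob (HX.1 None) t23') (Ex4 (fun _ _ a b => a != b) mX).
have eIJS : Ex (dist S) cIJ = flip_prob (t1 - t0) * flip_prob (t3 - t2).
  rewrite (Ex4 (fun a b c e => (a != b) && (c != e)) mX).
  have hA : history (X None) `[0, t2] [set w | X None t0 w != X None t1 w].
    (* A [history] is generated by one-time events, so the change event is rebuilt from them by
       intersections and complements. *)
    rewrite [Z in history _ _ Z](_ : _ =
        ~` (X None t0 @^-1` [set true] `&` X None t1 @^-1` [set true]) `&`
        ~` (X None t0 @^-1` [set false] `&` X None t1 @^-1` [set false])).
      have h t b : 0 <= t <= t2 -> history (X None) `[0, t2] (X None t @^-1` [set b]).
        by move=> ht; apply: history_event; rewrite /= in_itv.
      by apply: historyI; apply: historyC; apply: historyI; apply: h; apply/andP; split => //;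
        exact: le_trans t12.
    apply/seteqP; split => w /=; case: (X None t0 w); case: (X None t1 w) => //=.
    - by move=> _; split=> -[].
    - by move=> _; split=> -[].
    - by case=> -[].
    - by case=> _ [].
  have := @chain_flip _ _ _ P _ (HX.1 None) t2 (t3 - t2) _ t20.
  rewrite subr_ge0 => /(_ _ t23 hA); rewrite [t2 + _]addrC subrK.
  rewrite -[pr [set w | X None t0 w != _]]/(change_prob (X None) t0 t1)
    (chain_change_prob (HX.1 None) t01') => <-.
  by congr proba; apply/seteqP; split => w /=; [move=> /andP[]|move=> [-> ->]].
have eBS x y : Ex (dist S) (B x y) =
  if x == y then (1 - flip_prob (t2 - t1)) / 2 else flip_prob (t2 - t1) / 2.
  by rewrite -(chain_pair_law x y (HX.1 None) t12') (Ex4 (fun _ a b _ =>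
    (a == x) && (b == y)) mX).
have chgE (Z : vertex n -> R -> T -> bool) a b : GD Z -> 0 <= a -> a <= b ->
    change_prob (out n Z) a b = r a b.
  move=> HZ a0 ab; have a0' : 0 <= a + 0 by rewrite addr0.
  by rewrite (change_prob_shift HZ HL a0 a0' ab) !addr0.
have eI (Z : vertex n -> R -> T -> bool) : GD Z -> Ex (dist (traj (out n Z) ts 3)) cI = r t0 t1.
  move=> HZ; rewrite -(chgE Z)// (Ex4 (fun a b _ _ => a != b))// => t b; exact: mO.
have eJ (Z : vertex n -> R -> T -> bool) : GD Z -> Ex (dist (traj (out n Z) ts 3)) cJ = r t2 t3.
  move=> HZ; rewrite -(chgE Z)// (Ex4 (fun _ _ a b => a != b))// => t b; exact: mO.
have eB (Z : vertex n -> R -> T -> bool) x y : GD Z ->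
    Ex (dist (traj (out n Z) ts 3)) (B x y) = if x == y then (1 - r t1 t2) / 2 else r t1 t2 / 2.
  move=> HZ; rewrite -(chgE Z)// -output_pair_law//.
  by rewrite (Ex4 (fun _ a b _ => (a == x) && (b == y)))// => t b; exact: mO.
have eIJ (Z : vertex n -> R -> T -> bool) : GD Z ->
    Ex (dist (traj (out n Z) ts 3)) cIJ = joint_change_prob (out n XL) t0 t1 t2 t3.
  move=> HZ; have a0' : 0 <= t0 + 0 by rewrite addr0.
  have := joint_change_prob_shift HL HZ t00 a0' t012 t23; rewrite !addr0 => ->.
  by rewrite (Ex4 (fun a b c e => (a != b) && (c != e)))// => t b; exact: mO.
rewrite [leLHS](_ : _ = Ex (dist (traj (out n.+1 X) ts 3)) cIJ); last first.
  by rewrite (Ex4 (fun a b c e => (a != b) && (c != e)))// => t b; exact: mO.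
rewrite Ex_node//.
(* The neutral values depend on the root, so its states [x], [y] at the inner times are
   enumerated. *)
pose blk x y z := tensor3 (B x y) cIJ (B (~~ x) (~~ y)) z +
  tensor3 (B x y) (B (~~ x) (~~ y)) cIJ z.
pose rhs z := tensor3 one cI cJ z + tensor3 one cJ cI z + tensor3 cIJ one one z +
  (tensor3 cI cJ one z + tensor3 cI one cJ z) + (tensor3 cJ cI one z + tensor3 cJ one cI z) +
  (blk true true z + blk true false z + blk false true z + blk false false z).
have mS : fin_measurable S by exact: fin_measurable_traj.
have mL : fin_measurable (traj (out n XL) ts 3).
  exact: (fin_measurable_output (ge0 0) tsS HL).
have mV : fin_measurable (traj (out n XR) ts 3).
  exact: (fin_measurable_output (ge0 0) tsS HR).
apply: (@le_trans _ _ (Ex (prod3 (dist S) (dist (traj (out n XL) ts 3))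
   (dist (traj (out n XR) ts 3))) rhs)).
  apply: Ex_le => [x|[[s p] q]]; first by rewrite /prod3 !mulr_ge0// pmf_ge0.
  rewrite /rhs /blk /tensor3 /cI /cJ /cIJ /B /one !ffunE /=.
  have := gate_change_le (s (inord 0)) (s (inord 1)) (s (inord 2)) (s (inord 3))
    (p (inord 0)) (p (inord 1)) (p (inord 2)) (p (inord 3))
    (q (inord 0)) (q (inord 1)) (q (inord 2)) (q (inord 3)).
  rewrite -(ler_nat R) !natrD !natrM => /le_trans; apply.
  by case: (s (inord 1)) (s (inord 2)) => -[] /=; lra.
rewrite /rhs /blk !ExD !Ex_tensor3 eIS eJS eIJS !eBS !eI// !eJ// !eIJ// !eB// /one !Ex_cst//=.
by lra.
Qed.

Lemma change_prob_step :
  change_prob (out n.+1 X) t0 t1 = r t0 t1 - r t0 t1 ^+ 2 / 2 +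
    flip_prob (t1 - t0) * (1 / 2 - r t0 t1 + r t0 t1 ^+ 2).
Proof.
have [HL HR] := gate_dynamics_subtrees HX.
have /andP[t01 t12] := t012.
have t10 : 0 <= t1 := le_trans t00 t01.
have t01' : 0 <= t0 <= t1 by rewrite t00.
pose v0 x (a : {ffun 'I_4 -> bool}) : R := (a (inord 0) == x)%:R.
pose v1 x (a : {ffun 'I_4 -> bool}) : R := (a (inord 1) == x)%:R.
pose B x y (a : {ffun 'I_4 -> bool}) : R := ((a (inord 0) == x) && (a (inord 1) == y))%:R.
pose one (a : {ffun 'I_4 -> bool}) : R := 1.
pose S := traj (X None) ts 3.
have mX t b : 0 <= t -> measurable (X None t @^-1` [set b]).
  by move=> t0'; exact: (chain_measurable (HX.1 None)).
have mO m (Z : vertex m -> R -> T -> bool) t b : GD Z -> 0 <= t ->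
    measurable (out m Z t @^-1` [set b]).
  by move=> HZ t0'; exact: (measurable_output b HZ).
have eBS x y : Ex (dist S) (B x y) =
  if x == y then (1 - flip_prob (t1 - t0)) / 2 else flip_prob (t1 - t0) / 2.
  by rewrite -(chain_pair_law x y (HX.1 None) t01') (Ex4 (fun a b _ _ =>
    (a == x) && (b == y)) mX).
have chgE (Z : vertex n -> R -> T -> bool) : GD Z -> change_prob (out n Z) t0 t1 = r t0 t1.
  move=> HZ; have a0' : 0 <= t0 + 0 by rewrite addr0.
  by rewrite (change_prob_shift HZ HL t00 a0' t01) !addr0.
have eB (Z : vertex n -> R -> T -> bool) x y : GD Z ->
    Ex (dist (traj (out n Z) ts 3)) (B x y) = if x == y then (1 - r t0 t1) / 2 else r t0 t1 / 2.
  move=> HZ; rewrite -(chgE Z)// -output_pair_law//.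
  by rewrite (Ex4 (fun a b _ _ => (a == x) && (b == y)))// => t b; exact: mO.
have e0 (Z : vertex n -> R -> T -> bool) x : GD Z ->
    Ex (dist (traj (out n Z) ts 3)) (v0 x) = 1 / 2.
  move=> HZ; rewrite -(output_marginal x HZ t00) (Ex4 (fun a _ _ _ => a == x)).
    by congr proba; apply/seteqP; split => w /= /eqP.
  by move=> t b; exact: mO.
have e1 (Z : vertex n -> R -> T -> bool) x : GD Z ->
    Ex (dist (traj (out n Z) ts 3)) (v1 x) = 1 / 2.
  move=> HZ; rewrite -(output_marginal x HZ t10) (Ex4 (fun _ a _ _ => a == x)).
    by congr proba; apply/seteqP; split => w /= /eqP.
  by move=> t b; exact: mO.
rewrite [LHS](_ : _ = Ex (dist (traj (out n.+1 X) ts 3)) (fun a =>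
    (a (inord 0) != a (inord 1))%:R)); last first.
  by rewrite (Ex4 (fun a b _ _ => a != b))// => t b; exact: mO.
rewrite Ex_node//.
(* If the root state is [x] at both times, the output changes iff both children
   are neutral at exactly one of the two times; if the root flips, this is reversed. *)
pose blk x y z := tensor3 (B x y) (v0 (~~ x)) (v0 (~~ x)) z +
  tensor3 (B x y) (v1 (~~ y)) (v1 (~~ y)) z
  - 2 * tensor3 (B x y) (B (~~ x) (~~ y)) (B (~~ x) (~~ y)) z.
have mL : fin_measurable (traj (out n XL) ts 3).
  exact: (fin_measurable_output (ge0 0) tsS HL).
have mV : fin_measurable (traj (out n XR) ts 3).
  exact: (fin_measurable_output (ge0 0) tsS HR).
rewrite (eq_Ex _ (g := fun z => blk true true z + blk false false z +
    (tensor3 (B true false) one one z - blk true false z) +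
    (tensor3 (B false true) one one z - blk false true z))); last first.
  move=> [[s p] q]; rewrite /blk /tensor3 /v0 /v1 /B /one !ffunE /=.
  by case: (s (inord 0)) (s (inord 1)) (p (inord 0)) (p (inord 1)) (q (inord 0)) (q (inord 1))
    => -[] [] [] [] [] /=; ring.
rewrite /blk !(ExD, ExN, ExZ, Ex_tensor3) !eBS !eB// !e0// !e1// /one !Ex_cst//=.
by field.
Qed.

End Times.
End Node.
End Changes.

(** * The scalar recursion of the change probability *)

Section ScalarRecursion.
Context {R : realType}.

(** A fixed point satisfies [r^2 / 2 = l (1/2 - r + r^2)], so [r] is close to [sqrt l] for small
    [l]. *)
Fixpoint change_rec (l : R) (n : nat) : R :=
  if n is m.+1 then change_rec l m - change_rec l m ^+ 2 / 2 + l * (1 / 2 - change_rec l m +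
    change_rec l m ^+ 2)
  else l.

Lemma change_rec_range l n : 0 <= l <= 1 / 2 -> 0 <= change_rec l n <= 1 / 2.
Proof. by move=> hl; elim: n => [|n IH] /=; [lra|nra]. Qed.

Lemma change_rec_le_sqrt l n : 0 <= l <= 1 / 2 -> change_rec l n <= Num.sqrt l.
Proof.
move=> hl; have := sqrtr_ge0 l; have : Num.sqrt l ^+ 2 = l by rewrite sqr_sqrtr//; lra.
set u := Num.sqrt l => uE u0.
have u1 : u <= 3 / 4 by rewrite leNgt; apply/negP => ?; nra.
elim: n => [|n IH] /=; first nra.
have := change_rec_range n hl; set r := change_rec l n in IH * => r0; rewrite -uE.
(* With [phi] the one-step map, [u - phi u = u^3 (1 - u)] and [phi u - phi r] is the product in
   [h2]; [h1] is the sign of its second factor. *)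
have h1 : 0 <= 1 - (u + r) / 2 - u ^+ 2 * (1 - (u + r)).
  have [w1|w1] := leP (u + r) 1.
    have : u ^+ 2 * (1 - (u + r)) <= 1 / 2 * (1 - (u + r)) by rewrite ler_wpM2r//; lra.
    lra.
  have : 0 <= u ^+ 2 * (u + r - 1) by rewrite mulr_ge0 ?sqr_ge0//; lra.
  lra.
have h2 : 0 <= (u - r) * (1 - (u + r) / 2 - u ^+ 2 * (1 - (u + r))).
  by rewrite mulr_ge0//; lra.
have h3 : 0 <= u ^+ 3 * (1 - u) by rewrite mulr_ge0 ?exprn_ge0//; lra.
rewrite !exprS expr0 in h2 h3 *; lra.
Qed.

(** Below [sqrt l / 2] each level adds at least [l / 4 - l / 8], as [r^2 / 2 <= l / 8]; once that
    threshold is reached it is never lost. *)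
Lemma change_rec_ge_min l n : 0 <= l <= 1 / 2 ->
  Num.min (n%:R * l / 8) (Num.sqrt l / 2) <= change_rec l n.
Proof.
move=> hl; have := sqrtr_ge0 l; have : Num.sqrt l ^+ 2 = l by rewrite sqr_sqrtr//; lra.
set u := Num.sqrt l => uE u0.
have u1 : u <= 3 / 4 by rewrite leNgt; apply/negP => ?; nra.
elim: n => [|n IH] /=; first by rewrite ge_min; apply/orP; left; rewrite !mul0r; lra.
have := change_rec_range n hl; set r := change_rec l n in IH * => r0.
have q : 1 / 4 <= 1 / 2 - r + r ^+ 2 by have := sqr_ge0 (r - 1 / 2); nra.
have lq : l / 4 <= l * (1 / 2 - r + r ^+ 2).
  by have := ler_wpM2l (_ : 0 <= l) q; lra.
have [ru|ru] := leP (u / 2) r.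
  rewrite ge_min; apply/orP; right.
  have : u / 2 - (u / 2) ^+ 2 / 2 <= r - r ^+ 2 / 2 by nra.
  rewrite -uE in lq *; nra.
move: IH; rewrite ge_min => /orP[IH|]; last by lra.
rewrite ge_min; apply/orP; left; rewrite -natr1 mulrDl mul1r mulrDl.
have : r ^+ 2 <= l / 4 by rewrite -uE; nra.
lra.
Qed.

Lemma change_rec_ge l n : 0 <= l <= 1 / 2 -> 4 <= n%:R * l -> Num.sqrt l / 2 <= change_rec l n.
Proof.
move=> hl hn; apply: le_trans (change_rec_ge_min n hl); rewrite le_min lexx andbT.
have : Num.sqrt l <= 1 by rewrite -[leRHS]sqrtr1 ler_wsqrtr//; lra.
lra.
Qed.

Lemma exprn_le_inv (x : R) m : 0 <= x <= 1 -> (1 - x) ^+ m * (1 + m%:R * x) <= 1.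
Proof.
move=> hx; elim: m => [|m IH]; first by rewrite expr0; lra.
apply: le_trans IH; rewrite exprSr -mulrA ler_wpM2l ?exprn_ge0//; first lra.
rewrite -natr1; have : 0 <= m%:R * x ^+ 2 by rewrite mulr_ge0// sqr_ge0.
have := sqr_ge0 x; nra.
Qed.

Lemma exprn_le_of_inv (x h : R) m : 0 <= x <= 1 -> 0 < h -> h^-1 <= m%:R * x ->
  (1 - x) ^+ m <= h.
Proof.
move=> hx h0 big; have := exprn_le_inv m hx; set y := _ ^+ m.
have y0 : 0 <= y by rewrite exprn_ge0//; lra.
move=> e; rewrite -[leRHS]mul1r -ler_pdivrMr//; apply: le_trans e.
by rewrite ler_wpM2l//; lra.
Qed.

(** For [sh = sqrt h] and [sk = sqrt (k + 1)]: the stationary term gives [7 * 4 / 2 = 14], and the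
    transient [y <= sh^2 <= sh / sk] gives the remaining 1. *)
Lemma decay_bound (sh sk l y : R) : 0 < sh -> 0 < sk -> sh * sk <= 1 ->
  l <= sh ^+ 2 / 2 -> y <= sh ^+ 2 -> 7 * l / (sh * sk / 4) + y <= 15 * sh / sk.
Proof.
move=> sh0 sk0 hk hl hy.
have e1 : 7 * l / (sh * sk / 4) <= 14 * sh / sk.
  rewrite ler_pdivrMr ?divr_gt0 ?mulr_gt0// (_ : _ / sk * _ = 7 / 2 * sh ^+ 2); first lra.
  by field; rewrite gt_eqF.
have e2 : y <= sh / sk by apply: le_trans hy _; rewrite ler_pdivlMr//; nra.
by apply: le_trans (lerD e1 e2) _; rewrite -mulrDl; rewrite ler_pM2r ?invr_gt0//; lra.
Qed.

(** Telescoping: for consecutive square roots [a <= b], [b - a = 1 / (a + b) >= 1 / (2 b)]. *)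
Lemma sum_inv_sqrt K : \sum_(k < K) (Num.sqrt (k.+1%:R : R))^-1 <= 2 * Num.sqrt K%:R.
Proof.
elim: K => [|K IH]; first by rewrite big_ord0 sqrtr0 mulr0.
rewrite big_ord_recr/=; set a := Num.sqrt K%:R in IH *; set b := Num.sqrt K.+1%:R.
have a0 : 0 <= a := sqrtr_ge0 _.
have b0 : 0 < b by rewrite sqrtr_gt0 ltr0n.
have ab : b ^+ 2 = a ^+ 2 + 1 by rewrite !sqr_sqrtr ?ler0n// natr1.
have ba : a <= b by rewrite ler_wsqrtr// ler_nat.
have : b^-1 <= 2 * b - 2 * a.
  rewrite -[leLHS]mul1r ler_pdivrMr//; nra.
lra.
Qed.

End ScalarRecursion.

(** * Joint changes in two separated steps *)

Section ChangeBounds.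
Context {R : realType} {d : measure_display} {T : measurableType d}.
Variables (P : probability T R).
Local Notation pr := (proba P).
Local Notation dist := (pmf P).
Local Notation GD := (gate_dynamics P (1 / 2)).
Local Notation out n X := (output (@andor n) X).
Local Notation chg := (change_prob P).
Local Notation jchg := (joint_change_prob P).

Lemma change_prob_rec n (X : vertex n -> R -> T -> bool) s t : GD X -> 0 <= s -> s <= t ->
  chg (out n X) s t = change_rec (flip_prob (t - s)) n.
Proof.
elim: n X => [|n IH] X HX s0 st.
  by rewrite output_leaf (chain_change_prob (HX.1 tt)) ?s0.
have [HL HR] := gate_dynamics_subtrees HX.
have st' : s <= t <= t by rewrite st lexx.
by rewrite (change_prob_step HX s0 st' (lexx t)) IH.
Qed.

Lemma flip_prob_range (t : R) : 0 <= t -> 0 <= flip_prob t <= 1 / 2.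
Proof. by move=> t0; have := flip_prob_ge0 t0; have := flip_prob_lt_half t; lra. Qed.

Lemma measurable_joint_change n (X : vertex n -> R -> T -> bool) t0 t1 t2 t3 : GD X ->
  0 <= t0 -> 0 <= t1 -> 0 <= t2 -> 0 <= t3 ->
  measurable [set w | (out n X t0 w != out n X t1 w) && (out n X t2 w != out n X t3 w)].
Proof.
move=> HX t00 t10 t20 t30.
rewrite [X in measurable X](_ : _ = [set w | out n X t0 w != out n X t1 w] `&`
   [set w | out n X t2 w != out n X t3 w]); last first.
  by apply/seteqP; split => w /=; [move=> /andP[]|move=> [-> ->]].
by apply: measurableI; apply: (measurable_pair (fun a b => a != b)) => b;
  exact: (measurable_output b HX).
Qed.

Lemma joint_change_prob_le n (X : vertex n -> R -> T -> bool) t0 t1 t2 t3 : GD X ->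
  0 <= t0 -> 0 <= t1 -> 0 <= t2 -> 0 <= t3 ->
  jchg (out n X) t0 t1 t2 t3 <= chg (out n X) t0 t1.
Proof.
move=> HX t00 t10 t20 t30; apply: le_proba.
- exact: measurable_joint_change.
- by apply: (measurable_pair (fun a b => a != b)) => b; exact: (measurable_output b HX).
- by move=> w /= /andP[].
Qed.

(** Above the lowest [n1] levels the recursion reads [J' <= (1 - sg) J + 7 l] with
    [l = flip_prob h]: its fixed point is [7 l / sg] and its transient [(1 - sg)^m]. The 7 is
    [2 + 1 + 2 + 2] over the additive terms, using [r^2 <= l]. *)
Lemma joint_change_prob_decay n1 m (X : vertex (m + n1) -> R -> T -> bool) t0 t1 t2 t3 h sg :
  GD X -> 0 <= t0 -> t0 <= t1 <= t2 -> t2 <= t3 -> t1 - t0 = h -> t3 - t2 = h ->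
  0 < sg <= 1 -> (forall n, (n1 <= n)%N -> sg <= change_rec (flip_prob (t2 - t1)) n) ->
  jchg (out (m + n1) X) t0 t1 t2 t3 <= 7 * flip_prob h / sg + (1 - sg) ^+ m.
Proof.
move=> HX t00 t012 t23 h1 h2 sg0 hsg.
have /andP[t01 t12] := t012.
have t10 : 0 <= t1 := le_trans t00 t01.
have t20 : 0 <= t2 := le_trans t10 t12.
have t30 : 0 <= t3 := le_trans t20 t23.
have h0 : 0 <= h by rewrite -h1 subr_ge0.
have hl := flip_prob_range h0.
elim: m X HX => [|m IH] X HX.
  rewrite expr0; apply: (@le_trans _ _ 1).
    by apply: proba_le1; exact: measurable_joint_change.
  by rewrite lerDr divr_ge0//; lra.
have [HL HR] := gate_dynamics_subtrees HX.
apply: le_trans (joint_change_prob_step HX t00 t012 t23) _.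
rewrite !change_prob_rec// h1 h2.
have gl : 0 <= flip_prob (t2 - t1) <= 1 / 2 by apply: flip_prob_range; rewrite subr_ge0.
have := IH _ HL; set J := jchg _ _ _ _ _ => hJ.
have J0 : 0 <= J := proba_ge0 _ _.
have := hsg (m + n1)%N (leq_addl _ _).
have := change_rec_range (m + n1) gl; have := change_rec_range (m + n1) hl; have :=
  change_rec_le_sqrt (m + n1) hl.
have := sqrtr_ge0 (flip_prob h); have : Num.sqrt (flip_prob h) ^+ 2 =
  flip_prob h by rewrite sqr_sqrtr//; lra.
set u := Num.sqrt _; set r := change_rec (flip_prob h) _; set p := change_rec _ _; set l :=
  flip_prob h in hl hJ *; set g := flip_prob _ in gl *.
move=> uE u0 ru r01 p01 sgp.
have e1 : 2 * r * r + l * l + 2 * l * r + 2 * l * r <= 7 * l.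
  have : r * r <= l by rewrite -uE; nra.
  nra.
have e2 : (1 - g) * (1 - p) + g * p <= 1 - sg by nra.
have e3 := ler_wpM2r J0 e2.
have e4 : (1 - sg) * J <= (1 - sg) * (7 * l / sg + (1 - sg) ^+ m).
  by rewrite ler_wpM2l//; lra.
have e5 : (1 - sg) * (7 * l / sg) = 7 * l / sg - 7 * l.
  by field; rewrite gt_eqF//; lra.
rewrite exprS; rewrite mulrDr e5 in e4; lra.
Qed.

End ChangeBounds.

Lemma joint_change_prob_eventually (R : realType) (K : nat) : (0 < K)%N -> exists n0 : nat,
  forall d (T : measurableType d) (P : probability T R) n (X : vertex n -> R -> T -> bool),
  (n0 <= n)%N -> gate_dynamics P (1 / 2) X ->
  (4 <= n%:R * flip_prob K%:R^-1 :> R) /\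
  forall i k, (i + k.+1 < K)%N ->
  joint_change_prob P (output (@andor n) X) (i%:R / K%:R) (i.+1%:R / K%:R) ((i + k.+2)%:R / K%:R)
    ((i + k.+3)%:R / K%:R) <= 15 * Num.sqrt K%:R^-1 / Num.sqrt k.+1%:R.
Proof.
move=> K0; set h : R := K%:R^-1.
have Kr : (0 : R) < K%:R by rewrite ltr0n.
have h0 : 0 < h by rewrite invr_gt0.
have h1 : h <= 1 by rewrite invf_le1// ler1n.
have l0 : 0 < flip_prob h by apply: lt_le_trans (flip_prob_ge _);
  [rewrite divr_gt0|rewrite (ltW h0)].
pose sh := Num.sqrt h.
have sh0 : 0 < sh by rewrite sqrtr_gt0.
have shE : sh ^+ 2 = h by rewrite sqr_sqrtr// ltW.
have sh1 : sh <= 1 by rewrite -[leRHS]sqrtr1 ler_wsqrtr.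
(* After [n1] levels the change probability at the shortest gap [h], hence at every longer gap, has
   its square-root lower bound; [m0] further levels bring the transient below [h], because
   [sg >= sh / 4] for every [k]. *)
pose n1 := (Num.truncn (4 / flip_prob h)).+1.
pose m0 := (Num.truncn (4 / (sh * h))).+1.
exists (m0 + n1)%N => d T P n X n0n HX.
have hn1 : 4 <= n1%:R * flip_prob h.
  by rewrite -ler_pdivrMr// ltW// truncnS_gt.
have n1n : (n1 <= n)%N by apply: leq_trans n0n; exact: leq_addl.
split; first by apply: le_trans hn1 _; rewrite ler_wpM2r ?(ltW l0)// ler_nat.
move=> i k ik.
have sk0 : 0 < Num.sqrt (k.+1%:R : R) by rewrite sqrtr_gt0 ltr0n.
set sk := Num.sqrt (k.+1%:R : R) in sk0 *.
have skE : sk ^+ 2 = k.+1%:R by rewrite sqr_sqrtr.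
(* The gap between the end of step [i] and the start of step [i + k + 2]; equal and adjacent steps,
   without a gap, are treated separately later. *)
pose g : R := k.+1%:R * h.
have gE : (i + k.+2)%:R / K%:R - i.+1%:R / K%:R = g.
  by rewrite /g -mulrBl -natrB; [congr (_%:R * _); lia|lia].
have hE a : a.+1%:R / K%:R - a%:R / K%:R = h by rewrite -mulrBl -natrB// subSnn mul1r.
have g1 : g <= 1.
  rewrite /g ler_pdivrMr// mul1r ler_nat; lia.
have hg : h <= g by rewrite /g ler_peMl ?ler1n// ltW.
pose sg := sh * sk / 4.
have sgE : sg <= Num.sqrt (flip_prob g) / 2.
  have -> : sg = Num.sqrt (g / 4) / 2.
    rewrite (_ : g / 4 = (sh * sk / 2) ^+ 2).
      by rewrite sqrtr_sqr ger0_norm /sg ?mulr_ge0 ?invr_ge0 ?(ltW sh0) ?(ltW sk0)//; field.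
    by rewrite !exprMn shE skE /g; field.
  by rewrite ler_wpM2r// ler_wsqrtr// flip_prob_ge//; lra.
have hgl : 0 <= flip_prob g <= 1 / 2 by apply: flip_prob_range; lra.
have sgr m : (n1 <= m)%N -> sg <= change_rec (flip_prob g) m.
  move=> n1m; apply: le_trans sgE _; apply: change_rec_ge => //.
  apply: le_trans hn1 _; apply: ler_pM; rewrite ?ler_nat ?(ltW l0)//; exact: le_flip_prob.
have sg0 : 0 < sg by rewrite divr_gt0// mulr_gt0.
have sg1 : 0 < sg <= 1.
  by rewrite sg0/=; have := sgr _ (leqnn _); have := change_rec_range n1 hgl; lra.
have shsk : sh / 4 <= sg.
  by rewrite /sg ler_wpM2r// ler_peMr ?(ltW sh0)// -sqrtr1 ler_wsqrtr// ler1n.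
have nE : ((n - n1) + n1 = n)%N by rewrite subnK.
have tle a b : (a <= b)%N -> (a%:R / K%:R : R) <= b%:R / K%:R.
  by move=> ab; rewrite ler_wpM2r ?invr_ge0 ?ler0n// ler_nat.
have main : joint_change_prob P (output (@andor n) X) (i%:R / K%:R) (i.+1%:R / K%:R) ((i +
  k.+2)%:R / K%:R)
    ((i + k.+3)%:R / K%:R) <= 7 * flip_prob h / sg + (1 - sg) ^+ (n - n1).
  move: (n - n1)%N nE => m nE; subst n.
  apply: joint_change_prob_decay => //.
  - by apply/andP; split; apply: tle; rewrite ?leqnSn// -addn1 leq_add2l.
  - by apply: tle; rewrite leq_add2l.
  - by rewrite addnS hE.
  - by rewrite gE.
apply: le_trans main _.
apply: decay_bound => //.
- rewrite -(ler_sqr (_ : sh * sk \is Num.nneg)) ?nnegrE ?mulr_ge0 ?(ltW sh0) ?(ltW sk0)//.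
  by rewrite exprMn shE skE expr1n mulrC.
- by rewrite shE; exact: flip_prob_le.
rewrite shE; apply: exprn_le_of_inv => //.
  by case/andP: sg1 => /ltW -> ->.
apply: (@le_trans _ _ (m0%:R * (sh / 4))).
  have : 4 / (sh * h) <= m0%:R by rewrite ltW// truncnS_gt.
  rewrite ler_pdivrMr ?mulr_gt0// => e.
  clear - e h0; rewrite -[leLHS]mul1r ler_pdivrMr//; lra.
apply: ler_pM; rewrite ?ler_nat ?divr_ge0 ?(ltW sh0)//.
by rewrite leq_subRL// addnC.
Qed.

(** * Number of changes on a mesh *)

Section NumberOfChanges.
Context {R : realType} {d : measure_display} {T : measurableType d}.
Variables (P : probability T R).
Local Notation pr := (proba P).
Local Notation dist := (pmf P).
Local Notation GD := (gate_dynamics P (1 / 2)).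
Local Notation out n X := (output (@andor n) X).
Local Notation chg := (change_prob P).
Local Notation jchg := (joint_change_prob P).

Definition grid_changes K (a : {ffun 'I_K.+1 -> bool}) : nat :=
  \sum_(i < K) (a (inord i) != a (inord i.+1)).

Definition mesh K (i : nat) : R := grid 0 K%:R^-1 i.

Lemma meshE K i : mesh K i = i%:R / K%:R.
Proof. by rewrite /mesh /grid add0r. Qed.

Lemma mesh_le K i : mesh K i <= mesh K i.+1.
Proof. by apply: grid_le; rewrite invr_ge0. Qed.

Lemma mesh0 K : 0 <= mesh K 0.
Proof. by rewrite /mesh grid0. Qed.

Lemma mesh_ge0 K i : 0 <= mesh K i.
Proof. by rewrite meshE divr_ge0. Qed.

Section Moments.
Variables (Y : R -> T -> bool) (K : nat).
Hypothesis mY : forall t b, 0 <= t -> measurable (Y t @^-1` [set b]).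

Lemma fin_measurable_mesh : fin_measurable (traj Y (mesh K) K).
Proof. exact: (fin_measurable_traj (mesh0 K) (mesh_le K) mY). Qed.

Lemma Ex_grid_changes : Ex (dist (traj Y (mesh K) K)) (fun a => (grid_changes a)%:R) =
  \sum_(i < K) chg Y (mesh K i) (mesh K i.+1).
Proof.
transitivity (Ex (dist (traj Y (mesh K) K)) (fun a =>
    \sum_(i < K) (a (inord i) != a (inord i.+1))%:R)).
  by apply: eq_Ex => a; rewrite /grid_changes natr_sum.
rewrite Ex_sum; apply: eq_bigr => i _.
rewrite -(proba_fin_event P fin_measurable_mesh (fun a => a (inord i) != a (inord i.+1))).
by congr proba; apply/seteqP; split => w /=; rewrite !ffunE !inordK ?ltnS// ltnW.
Qed.

Lemma Ex_grid_changes_sqr : Ex (dist (traj Y (mesh K) K)) (fun a => (grid_changes a)%:R ^+ 2) =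
  \sum_(i < K) \sum_(j < K) jchg Y (mesh K i) (mesh K i.+1) (mesh K j) (mesh K j.+1).
Proof.
transitivity (Ex (dist (traj Y (mesh K) K)) (fun a =>
    \sum_(i < K) \sum_(j < K) ((a (inord i) != a (inord i.+1)) &&
      (a (inord j) != a (inord j.+1)))%:R)).
  apply: eq_Ex => a; rewrite /grid_changes natr_sum expr2 mulr_suml; apply: eq_bigr => i _.
  by rewrite mulr_sumr; apply: eq_bigr => j _; rewrite -natrM mulnb.
rewrite Ex_sum; apply: eq_bigr => i _; rewrite Ex_sum; apply: eq_bigr => j _.
rewrite -(proba_fin_event P fin_measurable_mesh (fun a => (a (inord i) != a (inord i.+1)) &&
      (a (inord j) != a (inord j.+1)))).
by congr proba; apply/seteqP; split => w /=; rewrite !ffunE !inordK ?ltnS// ltnW.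
Qed.

End Moments.

Lemma grid_changes_ge_ends K (a : {ffun 'I_K.+1 -> bool}) : (a ord0 != a ord_max)%:R <=
  (grid_changes a)%:R :> R.
Proof.
rewrite ler_nat.
suff H m : (m <= K)%N -> ((a (inord 0) != a (inord m)) <=
    \sum_(0 <= i < m) (a (inord i) != a (inord i.+1)))%N.
  have e0 : inord 0 = ord0 :> 'I_K.+1 by apply/val_inj; rewrite /= inordK.
  have eK : inord K = ord_max :> 'I_K.+1 by apply/val_inj; rewrite /= inordK.
  by rewrite -e0 -eK /grid_changes -(big_mkord xpredT (fun i =>
    (a (inord i) != a (inord i.+1)) : nat)) H.
elim: m => [|m IH] mK; first by rewrite eqxx.
rewrite big_nat_recr//=; have := IH (ltnW mK).
by case: (a (inord 0)) (a (inord m)) (a (inord m.+1)) => -[] [] //=; lia.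
Qed.

Lemma measurable_grid_changes n (X : vertex n -> R -> T -> bool) K (E : pred nat) : GD X ->
  measurable [set w | E (grid_changes (traj (out n X) (mesh K) K w))].
Proof.
move=> HX; have mO : fin_measurable (traj (out n X) (mesh K) K).
  exact: (fin_measurable_output (mesh0 K) (mesh_le K) HX).
exact: (measurable_fin_event mO (fun a => E (grid_changes a))).
Qed.

(* With children constantly 1 and 0 the output is the root gate, which differs at
   times 0 and 1 with probability at least 1/4 and, having at most 1/2 changes in
   mean, makes more than 3 changes with probability at most 1/8. *)
Lemma few_changes_step n (X : vertex n.+1 -> R -> T -> bool) K : (0 < K)%N -> GD X ->
  1 / 8 * (const_prob P (out n (fun v => X (Some (inl v)))) true 0 K%:R^-1 K *
           const_prob P (out n (fun v => X (Some (inl v)))) false 0 K%:R^-1 K) +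
    pr [set w | (3 < grid_changes (traj (out n.+1 X) (mesh K) K w))%N] <=
    pr [set w | (0 < grid_changes (traj (out n.+1 X) (mesh K) K w))%N] :> R.
Proof.
move=> K0 HX; pose XL v := X (Some (inl v)).
have [HL HR] := gate_dynamics_subtrees HX.
pose XR v := X (Some (inr v)).
have Kr : (0 : R) < K%:R by rewrite ltr0n.
have h0 : (0 : R) <= K%:R^-1 by rewrite invr_ge0.
have h1 : (K%:R^-1 : R) <= 1 by rewrite invf_le1// ler1n.
have mX t b : 0 <= t -> measurable (X None t @^-1` [set b]).
  by move=> t0; exact: (chain_measurable (HX.1 None)).
have mS : fin_measurable (traj (X None) (mesh K) K) by exact: fin_measurable_mesh.
have mO m (Z : vertex m -> R -> T -> bool) : GD Z -> fin_measurable (traj (out m Z) (mesh K) K).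
  by move=> HZ; exact: (fin_measurable_output (mesh0 K) (mesh_le K) HZ).
have splitE : pr [set w | (0 < grid_changes (traj (out n.+1 X) (mesh K) K w))%N] =
    pr [set w | (0 < grid_changes (traj (out n.+1 X) (mesh K) K w) <= 3)%N] +
    pr [set w | (3 < grid_changes (traj (out n.+1 X) (mesh K) K w))%N].
  rewrite -probaU.
  - congr proba; apply/seteqP; split => w /=; last by case=> [/andP[]//|]; exact: ltn_trans.
    by move=> ->; have [?|?] := leqP (grid_changes (traj (out n.+1 X) (mesh K) K w)) 3;
      [left|right].
  - exact: (measurable_grid_changes K (fun m => (0 < m <= 3)%N)).
  - exact: (measurable_grid_changes K (fun m => (3 < m)%N)).
  - by apply/seteqP; split => w //= -[/andP[_ h3]]; rewrite ltnNge h3.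
rewrite splitE lerD2r (proba_fin_event P (mO _ _ HX) (fun a => (0 < grid_changes a <= 3)%N)).
rewrite (Ex_node (mesh0 K) (mesh_le K) HX).
pose al b (a : {ffun 'I_K.+1 -> bool}) : R := [forall (i : 'I_K.+1 | xpredT i), a i == b]%:R.
have eal m (Z : vertex m -> R -> T -> bool) b : GD Z ->
    Ex (dist (traj (out m Z) (mesh K) K)) (al b) = const_prob P (out m Z) b 0 K%:R^-1 K.
  move=> HZ; rewrite -(proba_fin_event P (mO _ _ HZ) (fun a =>
    [forall (i : 'I_K.+1 | xpredT i), a i == b])).
  rewrite (traj_all _ xpredT); congr proba.
  by apply/seteqP; split => w /= H i iN; [|move=> _]; exact: H.
pose ends (a : {ffun 'I_K.+1 -> bool}) : R := (a ord0 != a ord_max)%:R.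
pose few (a : {ffun 'I_K.+1 -> bool}) : R := ((0 < grid_changes a <= 3)%N : bool)%:R.
refine (le_trans (y := Ex (prod3 (dist (traj (X None) (mesh K) K))
    (dist (traj (out n XL) (mesh K) K)) (dist (traj (out n XR) (mesh K) K)))
    (tensor3 few (al true) (al false))) _ _).
  rewrite Ex_tensor3 !eal// -[leRHS]mulrA.
  rewrite (const_prob_shift false K HR HL (lexx 0) (lexx 0) h0).
  apply: ler_wpM2r; first by rewrite mulr_ge0 ?const_prob_ge0.
  (* Pointwise, [ends - N / 4] is at most the indicator of [1 <= N <= 3], being nonpositive for
     [N = 0] and [N >= 4]. Its mean is at least [1/4 - 1/8]. *)
  apply: (@le_trans _ _ (Ex (dist (traj (X None) (mesh K) K))
      (fun a => ends a - 1 / 4 * (grid_changes a)%:R))); last first.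
    apply: Ex_pmf_le => a; have := grid_changes_ge_ends a; rewrite -/(ends a) /few.
    have en : 0 <= ends a <= 1 by rewrite /ends; case: (_ != _) => /=; lra.
    case: (grid_changes a) => [|[|[|[|m]]]] /=; try lra.
    have : (4 : R) <= m.+4%:R by rewrite ler_nat.
    lra.
  rewrite ExB ExZ Ex_grid_changes//.
  have -> : Ex (dist (traj (X None) (mesh K) K)) ends = flip_prob 1.
    rewrite -(proba_fin_event P mS (fun a => a ord0 != a ord_max)).
    rewrite -[in RHS](subr0 1) -(chain_change_prob (HX.1 None)); last by rewrite lexx ler01.
    congr proba; apply/seteqP; split => w /=;
      by rewrite !ffunE !meshE/= mul0r divff// gt_eqF.
  rewrite (eq_bigr (fun=> flip_prob K%:R^-1)); last first.
    move=> i _; rewrite (chain_change_prob (HX.1 None)) ?mesh_ge0 ?mesh_le//.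
    by congr flip_prob; rewrite /mesh /grid -natr1; ring.
  rewrite sumr_const card_ord -[X in _ - _ * X]mulr_natl.
  have l1 : 1 / 4 <= flip_prob (1 : R) by apply: flip_prob_ge; lra.
  have : K%:R * flip_prob K%:R^-1 <= K%:R * (K%:R^-1 / 2) :> R.
    by rewrite ler_wpM2l ?(ltW Kr)// flip_prob_le.
  rewrite mulrA divff ?gt_eqF//; lra.
apply: Ex_le => [x|[[s p] q]]; first by rewrite /prod3 !mulr_ge0// pmf_ge0.
rewrite /tensor3 /al /=.
case: (boolP [forall (i | xpredT i), p i == true]) => [/forall_inP p1|_];
  last by rewrite mulr0 mul0r.
case: (boolP [forall (i | xpredT i), q i == false]) => [/forall_inP q0|_]; last by rewrite mulr0.
rewrite !mulr1 /few (_ : gate_path (s, p, q) = s)//.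
apply/ffunP => i; rewrite ffunE/= (eqP (p1 i isT)) (eqP (q0 i isT)).
by case: (s i).
Qed.

(** Pairs of steps are sorted by their distance [k]: each [i] has at most one partner on either
    side. *)
Lemma sum_gap_le K (g : nat -> R) : (forall k, 0 <= g k) ->
  \sum_(i < K) \sum_(j < K) \sum_(k < K) g k * ((j == i + k :> nat)%N + (i == j + k :> nat)%N)%:R
  <= 2 * K%:R * \sum_(k < K) g k.
Proof.
move=> g0; rewrite (_ : 2 * K%:R * _ = \sum_(i < K) \sum_(k < K) 2 * g k); last first.
  by rewrite sumr_const card_ord -mulr_sumr -[RHS]mulr_natl; ring.
apply: ler_sum => i _; rewrite exchange_big/=; apply: ler_sum => k _.
rewrite -mulr_sumr mulrC ler_wpM2r// -natr_sum ler_nat big_split/=.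
have le1 (Q : pred 'I_K) : (forall j j', Q j -> Q j' -> j = j') -> (\sum_(j < K) Q j <= 1)%N.
  move=> uQ; have [/existsP[j Qj]|/existsPn nQ] := boolP [exists j, Q j].
    rewrite (bigD1 j)//= Qj big1// => j' j'j; apply/eqP; rewrite eqb0; apply/negP => Qj'.
    by move: j'j; rewrite (uQ _ _ Qj' Qj) eqxx.
  by rewrite big1// => j _; apply/eqP; rewrite eqb0.
rewrite -(addn1 1) leq_add//; apply: le1 => j j' /eqP e /eqP e'; apply/val_inj => /=; lia.
Qed.

End NumberOfChanges.

Lemma grid_changes_moments (R : realType) (K : nat) : (0 < K)%N -> exists n0 : nat,
  forall d (T : measurableType d) (P : probability T R) n (X : vertex n -> R -> T -> bool),
  (n0 <= n)%N -> gate_dynamics P (1 / 2) X ->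
  let law := pmf P (traj (output (@andor n) X) (mesh K) K) in
  Num.sqrt K%:R / 4 <= Ex law (fun a => (grid_changes a)%:R) /\
  Ex law (fun a => (grid_changes a)%:R ^+ 2) <= 64 * K%:R.
Proof.
move=> K0; have [n0 Hn0] := joint_change_prob_eventually R K0.
exists n0 => d T P n X n0n HX /=; have [nl hj] := Hn0 d T P n X n0n HX.
have Kr : (0 : R) < K%:R by rewrite ltr0n.
set h : R := K%:R^-1 in nl hj; set sh := Num.sqrt h in hj.
have h0 : 0 < h by rewrite invr_gt0.
have h1 : h <= 1 by rewrite invf_le1// ler1n.
have sh0 : 0 < sh by rewrite sqrtr_gt0.
have shE : sh ^+ 2 = h by rewrite sqr_sqrtr// ltW.
pose sK := Num.sqrt (K%:R : R).
have shK : sh * sK = 1 by rewrite -sqrtrM ?(ltW h0)// mulVf ?sqrtr1// gt_eqF.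
have sKK : sK ^+ 2 = K%:R by rewrite sqr_sqrtr// ltW.
have sK0 : 0 < sK by rewrite sqrtr_gt0.
have hl := flip_prob_range (ltW h0).
have mO t b : 0 <= t -> measurable (output (@andor n) X t @^-1` [set b]).
  by move=> t0; exact: (measurable_output b HX).
have chgE i : change_prob P (output (@andor n) X) (mesh K i) (mesh K i.+1) =
  change_rec (flip_prob h) n.
  rewrite change_prob_rec ?mesh_ge0 ?mesh_le//; congr (change_rec (flip_prob _) _).
  by rewrite /mesh /grid /h -natr1; ring.
rewrite Ex_grid_changes// Ex_grid_changes_sqr//; split.
  rewrite (eq_bigr (fun=> change_rec (flip_prob h) n)); last by move=> i _; exact: chgE.
  rewrite sumr_const card_ord -[leRHS]mulr_natl.
  have r1 := change_rec_ge hl nl.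
  have r2 : sh / 2 <= Num.sqrt (flip_prob h).
    rewrite (_ : sh / 2 = Num.sqrt (h / 4)).
      by rewrite ler_wsqrtr// flip_prob_ge// h1 ltW.
    by rewrite -shE (_ : _ / 4 = (sh / 2) ^+ 2) ?sqrtr_sqr ?ger0_norm//;
      [rewrite divr_ge0// ltW|field].
  rewrite -/sK (_ : sK / 4 = K%:R * (sh / 4)).
    by rewrite ler_wpM2l ?(ltW Kr)//; lra.
  by rewrite -sKK expr2 mulrA -(mulrA sK) (mulrC sK sh) shK mulr1.
(* Equal and adjacent steps are bounded by the probability of a single change, at most [sqrt h]. *)
pose g (k : nat) : R := if k is k'.+2 then 15 * sh / Num.sqrt k'.+1%:R else sh.
have g0 k : 0 <= g k.
  by case: k => [|[|k]] /=; rewrite ?(ltW sh0)// divr_ge0 ?sqrtr_ge0// mulr_ge0// ltW.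
have rsh : change_rec (flip_prob h) n <= sh.
  apply: le_trans (change_rec_le_sqrt n hl) _; rewrite ler_wsqrtr//.
  by have := flip_prob_le h; lra.
have jsym (a b c e : R) : joint_change_prob P (output (@andor n) X) a b c e =
  joint_change_prob P (output (@andor n) X) c e a b.
  by congr proba; apply/seteqP; split => w /=; rewrite andbC.
have jle i k : (i + k < K)%N ->
    joint_change_prob P (output (@andor n) X) (mesh K i) (mesh K i.+1) (mesh K (i +
      k)) (mesh K (i + k).+1) <= g k.
  move=> ik; have small : joint_change_prob P (output (@andor n) X) (mesh K i) (mesh K i.+1)
      (mesh K (i + k)) (mesh K (i + k).+1) <= sh.
    by apply: le_trans (joint_change_prob_le HX _ _ _ _) _; rewrite ?mesh_ge0// chgE.
  case: k => [|[|k]] in ik small *; [exact: small|exact: small|].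
  have ik' : (i + k.+1 < K)%N by move: ik; rewrite !addnS; apply: ltn_trans.
  by have := hj i k ik'; rewrite !meshE [(i + k.+3)%N]addnS.
apply: (@le_trans _ _ (\sum_(i < K) \sum_(j < K) \sum_(k < K)
    g k * ((j == i + k :> nat)%N + (i == j + k :> nat)%N)%:R)).
  apply: ler_sum => i _; apply: ler_sum => j _.
  have [ij|ji] := leqP i j.
    have kK : (j - i < K)%N by apply: leq_ltn_trans (ltn_ord j); exact: leq_subr.
    rewrite (bigD1 (Ordinal kK))//= subnKC// eqxx ler_wpDr//.
      by apply: sumr_ge0 => k _; rewrite mulr_ge0.
    apply: (@le_trans _ _ (g (j - i)%N)).
      by have := jle i (j - i)%N; rewrite subnKC//; apply.
    by rewrite ler_peMr// ler1n.
  have kK : (i - j < K)%N by apply: leq_ltn_trans (ltn_ord i); exact: leq_subr.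
  rewrite (bigD1 (Ordinal kK))//= (subnKC (ltnW ji)) eqxx ler_wpDr//.
    by apply: sumr_ge0 => k _; rewrite mulr_ge0.
  apply: (@le_trans _ _ (g (i - j)%N)).
    by rewrite jsym; have := jle j (i - j)%N; rewrite (subnKC (ltnW ji)); apply.
  by rewrite ler_peMr// ler1n addn1.
apply: le_trans (sum_gap_le K g0) _.
(* [32 = 2 + 30]: two terms [sh <= 1], and [15 sh * 2 sK] with [sh * sK = 1]. *)
rewrite (_ : 64 * K%:R = 2 * K%:R * 32 :> R); last by ring.
rewrite ler_wpM2l ?mulr_ge0//.
apply: (@le_trans _ _ (2 * sh + 15 * sh * \sum_(k < K) (Num.sqrt (k.+1%:R : R))^-1)).
  (* The sum is extended by two nonnegative terms, so the first two can be split off even when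
     [K < 2]. *)
  have gs m : \sum_(k < m.+2) g k =
      2 * sh + 15 * sh * \sum_(k < m) (Num.sqrt (k.+1%:R : R))^-1.
    elim: m => [|m IH]; first by rewrite !big_ord_recr !big_ord0/=; ring.
    by rewrite big_ord_recr IH [in RHS]big_ord_recr/= mulrDr addrA.
  rewrite -gs big_ord_recr big_ord_recr /= -addrA lerDl.
  by apply: addr_ge0; [exact: (g0 K)|exact: (g0 K.+1)].
have := sum_inv_sqrt (R := R) K; rewrite -/sK => s2.
have : 15 * sh * \sum_(k < K) (Num.sqrt (k.+1%:R : R))^-1 <= 15 * sh * (2 * sK).
  by rewrite ler_wpM2l// mulr_ge0// ltW.
rewrite (_ : 15 * sh * (2 * sK) = 30 * (sh * sK)); last by ring.
have : sh <= 1 by rewrite -[leRHS]sqrtr1 ler_wsqrtr.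
rewrite shK; lra.
Qed.

(* Paley-Zygmund: truncate at [M] and apply AM-GM to [N * 1_{N > M}]. *)
Lemma many_changes (R : realType) (M K : nat) : (0 < K)%N -> 16 * M%:R <= Num.sqrt (K%:R : R) ->
  exists n0 : nat,
  forall d (T : measurableType d) (P : probability T R) n (X : vertex n -> R -> T -> bool),
  (n0 <= n)%N -> gate_dynamics P (1 / 2) X ->
  1 / 2048 <= proba P [set w | (M < grid_changes (traj (output (@andor n) X) (mesh K) K w))%N].
Proof.
move=> K0 MK; have [n0 Hn0] := grid_changes_moments R K0.
exists n0 => d T P n X n0n HX; have /= [e1 e2] := Hn0 d T P n X n0n HX.
have Kr : (0 : R) < K%:R by rewrite ltr0n.
set v := Num.sqrt (K%:R : R) in MK e1.
have v0 : 0 < v by rewrite sqrtr_gt0.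
have vE : v ^+ 2 = K%:R by rewrite sqr_sqrtr// ltW.
have mO : fin_measurable (traj (output (@andor n) X) (mesh K) K).
  exact: (fin_measurable_output (mesh0 K) (mesh_le K) HX).
rewrite (proba_fin_event P mO (fun a => (M < grid_changes a)%N)).
set D := pmf P _ in e1 e2 *; set p := Ex D _.
(* This [c] makes the second-moment term at most [64 v^2 / (1024 v) = v / 16]. With [M <= v / 16],
   the mean [v / 4] leaves [v / 8 <= c p], that is [p >= 1 / 2048]. *)
have [c [c0 cE]] : exists c : R, 0 < c /\ c = 256 * v by exists (256 * v); split; [lra|].
have c4 : 0 < 4 * c by lra.
have : Ex D (fun a => (grid_changes a)%:R) <=
    Ex D (fun a => M%:R + ((4 * c)^-1 * (grid_changes a)%:R ^+ 2 + c * (M < grid_changes a)%:R)).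
  apply: Ex_pmf_le => a; set N : R := (grid_changes a)%:R.
  have [Mn|nM] := ltnP M (grid_changes a); last first.
    rewrite mulr0 addr0; apply: (@le_trans _ _ M%:R); first by rewrite ler_nat.
    by rewrite lerDl mulr_ge0 ?sqr_ge0 ?invr_ge0 ?(ltW c4).
  rewrite mulr1 (_ : (4 * c)^-1 * N ^+ 2 + c = N + (N - 2 * c) ^+ 2 / (4 * c)); last first.
    by field; rewrite gt_eqF.
  have : 0 <= (N - 2 * c) ^+ 2 / (4 * c) by rewrite divr_ge0 ?sqr_ge0 ?(ltW c4).
  have : (0 : R) <= M%:R by [].
  lra.
rewrite !ExD !ExZ Ex_cst// -/p => e3.
have e4 : (4 * c)^-1 * Ex D (fun a => (grid_changes a)%:R ^+ 2) <= v / 16.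
  rewrite mulrC ler_pdivrMr//; apply: le_trans e2 _; rewrite -vE cE; lra.
have e5 : v / 8 <= c * p by lra.
rewrite cE in e5; have {}e5 : v * (1 / 8) <= v * (256 * p) by lra.
by move: e5; rewrite ler_pM2l//; lra.
Qed.

(** * Paths *)

Section Paths.
Context {R : realType}.
Implicit Types (x : R -> bool) (A : set R).

Lemma at_left_ball (t : R) (Q : R -> Prop) : (\forall s \near t^'-, Q s) ->
  exists2 e, 0 < e & forall s, t - e < s < t -> Q s.
Proof.
move=> [e /= e0 H]; exists e => // s /andP[s1 s2]; apply: H => //=.
by rewrite gtr0_norm ?subr_gt0//; lra.
Qed.

Lemma at_right_ball (t : R) (Q : R -> Prop) : (\forall s \near t^'+, Q s) ->
  exists2 e, 0 < e & forall s, t < s < t + e -> Q s.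
Proof.
move=> [e /= e0 H]; exists e => // s /andP[s1 s2]; apply: H => //=.
by rewrite ltr0_norm ?subr_lt0//; lra.
Qed.

Lemma counting_gt A (M : nat) :
  (M%:R%:E < counting A :> \bar R)%E <->
  exists s : seq R, [/\ uniq s, (M < size s)%N & forall t, t \in s -> A t].
Proof.
rewrite /counting; case: asboolP => [finA|infA]; split.
- rewrite lte_fin ltr_nat => MA; exists (finmap.enum_fset (fset_set A)); split => //.
    exact: finmap.fset_uniq.
  by move=> t; rewrite in_fset_set// inE.
- move=> [s [us Ms sA]]; rewrite lte_fin ltr_nat; apply: leq_trans Ms _.
  by apply: uniq_leq_size => // t ts; rewrite in_fset_set// inE; exact: sA.
- move=> _; have [B BA MB] := infinite_set_fset M.+1 infA.
  exists (finmap.enum_fset B); split => //; first exact: finmap.fset_uniq.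
- by rewrite ltry.
Qed.

(** Take the supremum [t] of the times up to which the path keeps the value [x u]. If [x t] differs
    from [x u], then [t] is a jump; otherwise right-continuity would prolong the constancy beyond
    [t]. *)
Lemma jump_between x u v : cadlag x -> 0 <= u -> u < v -> x u != x v ->
  exists2 t, u < t <= v & ~ \forall s \near t^'-, x s = x t.
Proof.
move=> [cr cl] u0 uv xuv.
pose S := [set t | u <= t <= v /\ forall s, u <= s <= t -> x s = x u].
have Su : S u.
  by split=> [|s us]; [rewrite lexx ltW|congr x; apply/le_anti; rewrite andbC].
have supS : has_sup S.
  by split; [exists u|exists v => t [/andP[]]].
set t := sup S.
have ut : u <= t by exact: sup_upper_bound.
have tv : t <= v by apply: ge_sup; [exists u|move=> r [/andP[]]].
have below s : u <= s < t -> x s = x u.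
  move=> /andP[us st]; have e0 : 0 < t - s by rewrite subr_gt0.
  have [r [_ Sr] sr] := sup_adherent e0 supS.
  by apply: Sr; rewrite us ltW//; move: sr; rewrite -/t opprB addrC subrK.
have [xtu|xtu] := eqVneq (x t) (x u); last first.
  have ult : u < t.
    by rewrite lt_neqAle ut andbT; apply/eqP => ut'; move: xtu; rewrite -ut' eqxx.
  exists t; first by rewrite ult.
  move=> /at_left_ball[e e0 H].
  pose s := Num.max ((u + t) / 2) (t - e / 2).
  have st : s < t by rewrite gt_max; apply/andP; split; lra.
  have us : u <= s by rewrite le_max; apply/orP; left; lra.
  have es : t - e < s by rewrite lt_max; apply/orP; right; lra.
  by move: xtu; rewrite -(H s) ?es// below ?us// eqxx.
have tv' : t < v.
  rewrite lt_neqAle tv andbT; apply/eqP => tv'; move: xuv.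
  by rewrite -tv' xtu eqxx.
have [e e0 H] := at_right_ball (cr t (le_trans u0 ut)).
pose r := Num.min v (t + e / 2).
have tr : t < r by rewrite lt_min tv'; lra.
have rv : r <= v by rewrite ge_min lexx.
have re : r <= t + e / 2 by rewrite ge_min lexx orbT.
suff : S r by move=> /(sup_upper_bound supS); rewrite leNgt tr.
split; first by rewrite rv andbT (le_trans ut)// ltW.
move=> s /andP[us sr]; have [st|ts] := ltP s t; first by rewrite below// us.
move: ts; rewrite le_eqVlt => /predU1P[<-//|ts].
by rewrite H ?ts//=; lra.
Qed.

Lemma change_window x t : cadlag x -> 0 < t -> ~ (\forall s \near t^'-, x s = x t) ->
  exists2 e, 0 < e & forall a b, t - e < a < t -> t <= b < t + e -> x a != x b.
Proof.
move=> [cr cl] t0 nt; have [c /at_left_ball[e e0 He]] := cl t t0.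
have [e' e'0 He'] := at_right_ball (cr t (ltW t0)).
have ct : c != x t.
  apply/eqP => ct; apply: nt; exists e => //= s /= ts st; rewrite -ct; apply: He.
  by rewrite st andbT; move: ts; rewrite gtr0_norm ?subr_gt0//; lra.
exists (Num.min e e'); first by rewrite lt_min e0.
move=> a b; have m1 : Num.min e e' <= e by rewrite ge_min lexx.
have m2 : Num.min e e' <= e' by rewrite ge_min lexx orbT.
move=> /andP[a1 a2] /andP[b1 b2]; rewrite He; last by rewrite a2 andbT; lra.
move: b1; rewrite le_eqVlt => /predU1P[<-//|b1].
by rewrite He' ?b1//=; lra.
Qed.

Lemma common_radius (s : seq R) (Q : R -> R -> Prop) :
  (forall t e e', 0 < e' <= e -> Q t e -> Q t e') ->
  (forall t, t \in s -> exists2 e, 0 < e & Q t e) ->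
  exists2 e, 0 < e & forall t, t \in s -> Q t e.
Proof.
move=> mQ; elim: s => [|a s IH] H; first by exists 1.
have [e e0 He] := IH (fun t ts => H t (mem_behead (s := a :: s) ts)).
have [e' e'0 He'] := H a (mem_head _ _).
have m0 : 0 < Num.min e e' by rewrite lt_min e0.
exists (Num.min e e') => // t; rewrite inE => /predU1P[->|ts].
  by apply: mQ He'; rewrite m0 ge_min lexx orbT.
by apply: mQ (He t ts); rewrite m0 ge_min lexx.
Qed.

Definition changed x (K i : nat) : bool := x (mesh K i) != x (mesh K i.+1).

Lemma grid_changes_count x K : grid_changes (traj (T := unit) (fun t _ => x t) (mesh K) K tt) =
  count (changed x K) (iota 0 K).
Proof.
have -> : iota 0 K = index_iota 0 K by rewrite /index_iota subn0.
rewrite /grid_changes -sum1_count big_mkord [RHS]big_mkcond /=.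
by apply: eq_bigr => i _; rewrite !ffunE !inordK ?ltnS ?(ltnW (ltn_ord i))//
  -/(changed x K i); case: changed.
Qed.

(** Half-open mesh cells are disjoint, so change times found in distinct changed cells are distinct.
    Conversely, given [M + 1] change times, a mesh finer than their separation puts them in distinct
    cells, and one finer than the radii of [change_window] makes every such cell a changed one. *)
Lemma counting_changes x (M : nat) : cadlag x ->
  (M%:R%:E < counting (change_times x) :> \bar R)%E <->
  exists m, (M < count (changed x (2 ^ m)) (iota 0 (2 ^ m)))%N.
Proof.
move=> cx; split; last first.
  move=> [m]; set K := (2 ^ m)%N => MK.
  have K0 : (0 : R) < K%:R by rewrite ltr0n expn_gt0.
  (* Stated for every [i], with the default value 0, so that [choice] yields a total function. *)
  have ex i : exists t, (i < K)%N -> changed x K i ->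
      mesh K i < t <= mesh K i.+1 /\ change_times x t.
    have [/andP[iK ci]|/negP nci] := boolP ((i < K)%N && changed x K i); last first.
      by exists 0 => iK ci; exfalso; apply: nci; rewrite iK.
    have [|t tm nt] := jump_between cx (mesh_ge0 K i) _ ci.
      by rewrite !meshE ltr_pM2r ?invr_gt0// ltr_nat.
    exists t => _ _; split => //; split => //.
    have /andP[t1 t2] := tm; rewrite (le_lt_trans (mesh_ge0 K i) t1)/=.
    by apply: le_trans t2 _; rewrite meshE ler_pdivrMr// mul1r ler_nat.
  have [f Hf] := choice ex.
  pose r := [seq i <- iota 0 K | changed x K i].
  have rP i : i \in r -> (i < K)%N /\ changed x K i.
    by rewrite mem_filter mem_iota add0n => /andP[-> /andP[_ ->]].
  apply/counting_gt; exists [seq f i | i <- r]; split.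
  - rewrite map_inj_in_uniq ?filter_uniq ?iota_uniq// => i j /rP[iK ci] /rP[jK cj] fij.
    have [/andP[i1 i2] _] := Hf i iK ci; have [/andP[j1 j2] _] := Hf j jK cj.
    have lt a b : mesh K a < mesh K b.+1 :> R -> (a <= b)%N.
      by rewrite !meshE ltr_pM2r ?invr_gt0// ltr_nat ltnS.
    apply/eqP; rewrite eqn_leq; apply/andP; split; apply: lt.
      by apply: lt_le_trans i1 _; rewrite fij.
    by apply: lt_le_trans j1 _; rewrite -fij.
  - by rewrite size_map size_filter.
  - by move=> t /mapP[i /rP[iK ci] ->]; exact: (Hf i iK ci).2.
move=> /counting_gt[s [us Ms sA]].
have [e1 e10 H1] : exists2 e, 0 < e & forall t, t \in s ->
    forall a b, t - e < a < t -> t <= b < t + e -> x a != x b.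
  apply: (@common_radius s (fun t e => forall a b, t - e < a < t -> t <= b < t + e ->
    x a != x b)).
    move=> t e e' /andP[e'0 ee'] H a b /andP[a1 a2] /andP[b1 b2].
    by apply: H; apply/andP; split => //; lra.
  by move=> t /sA[/andP[t0 t1] nt]; exact: change_window.
have [e2 e20 H2] : exists2 e, 0 < e & forall t, t \in s -> forall t', t' \in s ->
    t' != t -> e <= `|t - t'|.
  apply: (@common_radius s (fun t e => forall t', t' \in s -> t' != t -> e <= `|t - t'|)).
    by move=> t e e' /andP[e'0 ee'] H t' ts' tt'; apply: le_trans (H _ ts' tt').
  move=> t ts; apply: (@common_radius s (fun t' e => t' != t -> e <= `|t - t'|)).
    by move=> t' e e' /andP[e'0 ee'] H tt'; apply: le_trans (H tt').
  move=> t' ts'; have [->|tt'] := eqVneq t' t; first by exists 1.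
  by exists `|t - t'| => //; rewrite normr_gt0 subr_eq0 eq_sym.
pose e := Num.min e1 e2.
have e0 : 0 < e by rewrite lt_min e10.
pose m := (Num.truncn e^-1).+1; exists m; set K := (2 ^ m)%N.
have K0 : (0 : R) < K%:R by rewrite ltr0n expn_gt0.
have Ke : K%:R^-1 < e.
  rewrite -[ltRHS]invrK ltf_pV2 ?posrE ?invr_gt0//.
  apply: lt_le_trans (truncnS_gt _) _; rewrite ler_nat; exact: ltnW (ltn_expl _ _).
have idx t : exists i, t \in s -> [/\ (i < K)%N & mesh K i < t <= mesh K i.+1].
  have [ts|nts] := boolP (t \in s); last by exists 0%N.
  have [/andP[t0 t1] _] := sA t ts.
  have exn : exists n, t <= mesh K n.+1.
    exists K; rewrite meshE; apply: le_trans t1 _.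
    by rewrite ler_pdivlMr// mul1r ler_nat.
  case: (ex_minnP exn) => i ti mi; exists i => _.
  have it : mesh K i < t.
    case: i ti mi => [|i] ti mi; first by rewrite /mesh grid0.
    by rewrite ltNge; apply/negP => /mi; rewrite ltnn.
  split; last by rewrite it.
  have := lt_le_trans it t1; rewrite meshE ltr_pdivrMr// mul1r ltr_nat.
  done.
have [f Hf] := choice idx.
have stepE i : mesh K i.+1 = mesh K i + K%:R^-1.
  by rewrite /mesh /grid -natr1; ring.
apply: leq_trans Ms _; rewrite -(size_map f) -size_filter; apply: uniq_leq_size.
  rewrite map_inj_in_uniq// => t t' ts ts' ftt'.
  apply/eqP; rewrite -[_ == _]negbK eq_sym; apply/negP => tt'.
  have [_ /andP[a1 a2]] := Hf t ts; have [_ /andP[b1 b2]] := Hf t' ts'.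
  have := H2 t ts t' ts' tt'; rewrite leNgt => /negP; apply.
  have ee2 : e <= e2 by rewrite ge_min lexx orbT.
  rewrite ftt' in a1 a2; rewrite stepE in a2 b2.
  by rewrite ltr_norml; apply/andP; split; lra.
move=> i /mapP[t ts ->]; have [fK /andP[a1 a2]] := Hf t ts.
rewrite mem_filter mem_iota add0n fK !andbT.
have ee1 : e <= e1 by rewrite ge_min lexx.
by apply: (H1 t ts); rewrite stepE in a2 *; apply/andP; split => //; lra.
Qed.

Lemma constant_on_unit x b : cadlag x ->
  (forall t, 0 <= t <= 1 -> x t = b) <->
  (forall m i, (i <= 2 ^ m)%N -> x (mesh (2 ^ m) i) = b).
Proof.
move=> [cr cl]; split.
  move=> H m i im; apply: H; rewrite mesh_ge0/= meshE ler_pdivrMr ?ltr0n ?expn_gt0//.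
  by rewrite mul1r ler_nat.
move=> H t /andP[t0 t1].
(* The point 1 cannot be approached from the right inside the unit interval, but it is a mesh
   point. *)
have := t1; rewrite le_eqVlt => /predU1P[->|t1'].
  by have := H 0%N 1%N (leqnn _); rewrite meshE expn0 divff ?oner_neq0.
have [e e0 He] := at_right_ball (cr t t0).
pose d := Num.min e (1 - t).
have d0 : 0 < d by rewrite lt_min e0 subr_gt0.
pose m := (Num.truncn d^-1).+1; set K := (2 ^ m)%N.
have K0 : (0 : R) < K%:R by rewrite ltr0n expn_gt0.
have Ke : K%:R^-1 < d.
  rewrite -[ltRHS]invrK ltf_pV2 ?posrE ?invr_gt0//.
  apply: lt_le_trans (truncnS_gt _) _; rewrite ler_nat; exact: ltnW (ltn_expl _ _).
have exn : exists n, t < mesh K n.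
  by exists K; rewrite meshE divff ?gt_eqF.
case: (ex_minnP exn) => i ti mi.
have i0 : (0 < i)%N by case: i ti {mi} => //; rewrite /mesh grid0 ltNge t0.
have it : mesh K i <= t + K%:R^-1.
  case: i i0 ti mi => // i _ ti mi; rewrite (_ : mesh K i.+1 = mesh K i + K%:R^-1); last first.
    by rewrite /mesh /grid -natr1; ring.
  rewrite lerD2r leNgt; apply/negP => /mi; by rewrite ltnn.
have de : d <= e by rewrite ge_min lexx.
have d1 : d <= 1 - t by rewrite ge_min lexx orbT.
rewrite -(He (mesh K i)); last by rewrite ti/=; lra.
apply: H; have : mesh K i <= 1 :> R by lra.
by rewrite meshE ler_pdivrMr// mul1r ler_nat.
Qed.

End Paths.

(** * Passage to the limit *)

Section Refinement.
Context {R : realType}.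
Implicit Types (x : R -> bool).

Lemma mesh_double K i : mesh K.*2 i.*2 = mesh K i :> R.
Proof.
rewrite !meshE -!mul2n !natrM invfM mulrACA divff ?mul1r//.
Qed.

Lemma count_changed_double x K :
  (count (changed x K) (iota 0 K) <= count (changed x K.*2) (iota 0 K.*2))%N.
Proof.
suff H n : (count (changed x K) (iota 0 n) <= count (changed x K.*2) (iota 0 n.*2))%N by [].
elim: n => // n IH; rewrite doubleS -[n.+1]addn1 -addn2 !iotaD !count_cat leq_add//= !add0n !addn0.
rewrite /changed -doubleS !mesh_double.
case: (x (mesh K n)) (x (mesh K n.+1)) (x (mesh K.*2 n.*2.+1)) => -[] [] //.
Qed.

Lemma count_changed_le x m m' : (m <= m')%N ->
  (count (changed x (2 ^ m)) (iota 0 (2 ^ m)) <=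
   count (changed x (2 ^ m')) (iota 0 (2 ^ m')))%N.
Proof.
elim: m' => [|m' IH]; first by rewrite leqn0 => /eqP ->.
rewrite leq_eqVlt => /predU1P[->//|mm']; apply: leq_trans (IH mm') _.
by rewrite expnS mul2n count_changed_double.
Qed.

Lemma window_le x b m m' : (m <= m')%N ->
  (forall i, (i <= 2 ^ m')%N -> x (mesh (2 ^ m') i) = b) ->
  forall i, (i <= 2 ^ m)%N -> x (mesh (2 ^ m) i) = b.
Proof.
elim: m' => [|m' IH]; first by rewrite leqn0 => /eqP ->.
rewrite leq_eqVlt => /predU1P[->//|mm'] H; apply: IH => // i im.
by rewrite -mesh_double -mul2n -expnS H// expnS mul2n leq_double.
Qed.

End Refinement.

Section SetLimits.
Context {R : realType} {d : measure_display} {T : measurableType d}.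
Variables (P : probability T R).
Local Notation pr := (proba P).

Lemma proba_bigcup_le (F : nat -> set T) c : (forall m, measurable (F m)) ->
  (forall m m', (m <= m')%N -> F m `<=` F m') ->
  (forall m, pr (F m) <= c) -> pr (\bigcup_m F m) <= c.
Proof.
move=> mF hF le.
have mU : measurable (\bigcup_m F m) by exact: bigcup_measurable.
have cv : (P \o F) m @[m --> \oo] --> P (\bigcup_m F m).
  by apply: nondecreasing_cvg_mu => // m m' mm'; apply/subsetPset; exact: hF.
rewrite -lee_fin -probaE// -(cvg_lim _ cv)//; apply: lime_le.
  by apply/cvg_ex; eexists; exact: cv.
by apply: nearW => m /=; rewrite probaE// lee_fin.
Qed.

Lemma proba_bigcap_ge (F : nat -> set T) c : (forall m, measurable (F m)) ->
  (forall m m', (m <= m')%N -> F m' `<=` F m) ->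
  (forall m, c <= pr (F m)) -> c <= pr (\bigcap_m F m).
Proof.
move=> mF hF le.
have mU : measurable (\bigcap_m F m) by exact: bigcapT_measurable.
have P0 : (P (F 0%N) < +oo)%E by rewrite probaE// ltry.
have cv : (P \o F) m @[m --> \oo] --> P (\bigcap_m F m).
  by apply: nonincreasing_cvg_mu => // m m' mm'; apply/subsetPset; exact: hF.
rewrite -lee_fin -(probaE P mU) -(cvg_lim _ cv)//; apply: lime_ge.
  by apply/cvg_ex; eexists; exact: cv.
by apply: nearW => m /=; rewrite probaE// lee_fin.
Qed.

End SetLimits.

(** * Events of the number of changes for one tree *)

Section OneTree.
Context {R : realType} {d : measure_display} {T : measurableType d}.
Variables (P : probability T R).
Local Notation pr := (proba P).
Local Notation GD := (gate_dynamics P (1 / 2)).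
Local Notation out n X := (output (@andor n) X).

Lemma cadlag_output n (X : vertex n -> R -> T -> bool) w : GD X ->
  cadlag (fun t => out n X t w).
Proof.
move=> [HX _]; split=> [t t0|t t0].
  have H v : \forall s \near t^'+, X v s w = X v t w.
    exact: (sc_cadlag (HX v) w).1.
  apply: (filterS _ (filter_forall _ H)) => s Hs; rewrite /output.
  by congr andor; apply/funext => v; exact: Hs.
have H v : exists b, \forall s \near t^'-, X v s w = b by exact: (sc_cadlag (HX v) w).2.
have [b Hb] := choice H; exists (andor b).
apply: (filterS _ (filter_forall _ Hb)) => s Hs; rewrite /output.
by congr andor; apply/funext => v; exact: Hs.
Qed.

Section Fixed.
Variables (n : nat) (X : vertex n -> R -> T -> bool).
Hypothesis HX : GD X.
Let C w : \bar R := num_changes (@andor n) X w.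
Let N m w := grid_changes (traj (out n X) (mesh (2 ^ m)) (2 ^ m) w).

Let N_count m w : N m w = count (changed (fun t => out n X t w) (2 ^ m)) (iota 0 (2 ^ m)).
Proof.
by rewrite -grid_changes_count. Qed.

Lemma num_changes_gtE (M : nat) :
  [set w | (M%:R%:E < C w)%E] = \bigcup_m [set w | (M < N m w)%N].
Proof.
apply/seteqP; split => w /=.
  move=> /(counting_changes M (cadlag_output w HX))[m Mm].
  by exists m => //=; rewrite N_count.
move=> [m _ /= Mm]; apply/(counting_changes M (cadlag_output w HX)).
by exists m; rewrite -N_count.
Qed.

Let mN m M : measurable [set w | (M < N m w)%N].
Proof. exact: (measurable_grid_changes (2 ^ m) (fun k => (M < k)%N) HX). Qed.

Lemma measurable_num_changes_gt (M : nat) : measurable [set w | (M%:R%:E < C w)%E].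
Proof. by rewrite num_changes_gtE; apply: bigcup_measurable. Qed.

Lemma num_changes_gt_ge (M m : nat) :
  pr [set w | (M < N m w)%N] <= pr [set w | (M%:R%:E < C w)%E].
Proof.
apply: le_proba => //; first exact: measurable_num_changes_gt.
by rewrite num_changes_gtE => w; exists m.
Qed.

Lemma num_changes_ge0 w : (0 <= C w)%E.
Proof. by rewrite /C /num_changes /counting; case: ifP => _; rewrite ?lee_fin ?leey. Qed.

Lemma num_changes_eq0E : [set w | C w = 0%E] = ~` [set w | (0%:R%:E < C w)%E].
Proof.
apply/seteqP; split => w /=; first by move=> ->; rewrite ltxx.
by move=> /negP; rewrite -leNgt => C0; apply/le_anti; rewrite C0 num_changes_ge0.
Qed.

Lemma num_changes_betweenE (k : nat) :
  [set w | (1 <= C w <= k%:R%:E)%E] =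
  [set w | (0%:R%:E < C w)%E] `\` [set w | (k%:R%:E < C w)%E].
Proof.
have C1 w : (1 <= C w)%E = (0%:R%:E < C w)%E.
  rewrite /C /num_changes /counting; case: ifP => _; last by rewrite leey ltry.
  by rewrite lee_fin lte_fin ler1n ltr0n.
apply/seteqP; split => w /=.
  by rewrite C1 => /andP[-> Ck]; split => //; apply/negP; rewrite -leNgt.
by rewrite C1 => -[-> /negP]; rewrite -leNgt.
Qed.

Definition always b := [set w | forall t, 0 <= t <= 1 -> out n X t w = b].

Let window m b := [set w | forall i, (i <= 2 ^ m)%N -> out n X (mesh (2 ^ m) i) w = b].

Lemma alwaysE b : always b = \bigcap_m (window m b).
Proof.
apply/seteqP; split => w /=.
  by move=> /(constant_on_unit b (cadlag_output w HX)) H m _; exact: H.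
by move=> H; apply/(constant_on_unit b (cadlag_output w HX)) => m; exact: (H m I).
Qed.

Let mW m b : measurable (window m b).
Proof. by apply: (measurable_window b (2 ^ m) HX (lexx 0)); rewrite invr_ge0. Qed.

Lemma measurable_always b : measurable (always b).
Proof. by rewrite alwaysE; exact: bigcapT_measurable. Qed.

(** Since [2^-8 <= 1/144], eight doublings lead from an admissible short window to the unit
    interval. On the finer mesh of [2^(m + 8)] steps the short window has [2^m] steps, so the
    constant does not depend on [m]. *)
Lemma window_ge m b : floor_const 8 <= pr (window m b).
Proof.
have K0 : (0 : R) < (2 ^ (m + 8))%:R by rewrite ltr0n expn_gt0.
apply: (@le_trans _ _ (pr (window (m + 8) b))); last first.
  apply: le_proba => //; move=> w /=; exact: (@window_le _ (fun t =>
    out n X t w) b _ _ (leq_addr _ _)).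
apply: const_prob_doubling => //.
- rewrite natrX exprD invfM mulrA divff ?expf_neq0// !mul1r.
  by rewrite lef_pV2 ?posrE -?natrX ?ltr0n// ler_nat.
- by rewrite -natrX divff// gt_eqF.
Qed.

Lemma always_ge b : floor_const 8 <= pr (always b).
Proof.
rewrite alwaysE; apply: proba_bigcap_ge => // [m m' mm'|m]; last exact: window_ge.
by move=> w /=; exact: (@window_le _ (fun t => out n X t w)).
Qed.

Lemma always_le b : pr (always b) <= 1 / 2.
Proof.
rewrite -(output_marginal b HX (lexx 0)); apply: le_proba.
- exact: measurable_always.
- exact: (measurable_output b HX).
- by move=> w; apply; rewrite lexx ler01.
Qed.

Lemma num_changes_eq0_ge : floor_const 8 <= pr [set w | C w = 0%E].
Proof.
apply: le_trans (always_ge true) _; apply: le_proba.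
- exact: measurable_always.
- by rewrite num_changes_eq0E; apply: measurableC; exact: measurable_num_changes_gt.
- rewrite num_changes_eq0E num_changes_gtE => w aw [m _ /=].
  rewrite N_count -has_count => /hasP[i]; rewrite mem_iota add0n => /= iK.
  rewrite /changed !aw ?eqxx//; rewrite mesh_ge0 meshE ler_pdivrMr ?ltr0n ?expn_gt0//;
    by rewrite mul1r ler_nat// ltnW.
Qed.

End Fixed.

(** The event of one to three changes is not monotone in the mesh. The inequality
    [P(N > 3) <= P(C > 0) - c], valid on every mesh, does pass to the limit, because the events
    [N > 3] increase under refinement. *)
Lemma num_changes_few n (X : vertex n.+1 -> R -> T -> bool) : GD X ->
  1 / 8 * floor_const 8 ^+ 2 <=
  pr [set w | (1 <= num_changes (@andor n.+1) X w <= 3%:R%:E)%E].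
Proof.
move=> HX; have [HL HR] := gate_dynamics_subtrees HX.
have m0 := measurable_num_changes_gt HX 0; have m3 := measurable_num_changes_gt HX 3.
set c := 1 / 8 * _.
have trajN m w : grid_changes (traj (out n.+1 X) (mesh (2 ^ m)) (2 ^ m) w) =
    count (changed (fun t => out n.+1 X t w) (2 ^ m)) (iota 0 (2 ^ m)).
  by rewrite -grid_changes_count.
have key : pr [set w | (3%:R%:E < num_changes (@andor n.+1) X w)%E] <=
    pr [set w | (0%:R%:E < num_changes (@andor n.+1) X w)%E] - c.
  rewrite [in leLHS]num_changes_gtE//; apply: proba_bigcup_le => [m|m m' mm' w /=|m].
  - exact: (measurable_grid_changes (2 ^ m) (fun k => (3 < k)%N) HX).
  - by rewrite !trajN; move/leq_trans; apply; exact: count_changed_le.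
  - have K0 : (0 < 2 ^ m)%N by rewrite expn_gt0.
    have := few_changes_step K0 HX; have := num_changes_gt_ge HX 0 m.
    have := window_ge HL m true; have := window_ge HL m false.
    rewrite -/(const_prob P _ true 0 _ _) -/(const_prob P _ false 0 _ _).
    set a := const_prob P _ true 0 _ _; set b := const_prob P _ false 0 _ _ => hb ha h0 h1.
    have f0 := floor_const_gt0 (R := R) 8.
    have : floor_const 8 ^+ 2 <= a * b by rewrite expr2 ler_pM//; lra.
    rewrite /c; lra.
rewrite num_changes_betweenE.
set A := [set w | (0%:R%:E < _)%E] in m0 key *; set B := [set w | (3%:R%:E < _)%E] in m3 key *.
have BA : B `<=` A by move=> w; apply: lt_trans; rewrite lte_fin ltr_nat.
have : pr A = pr (A `\` B) + pr B.
  rewrite -probaU//; first by rewrite setUC setDUK.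
  - exact: measurableD.
  - by apply/seteqP; split => w // -[[_ nB] /nB].
lra.
Qed.

End OneTree.

Lemma num_changes_many (R : realType) (M : nat) : exists n0 : nat,
  forall d (T : measurableType d) (P : probability T R) n (X : vertex n -> R -> T -> bool),
  (n0 <= n)%N -> gate_dynamics P (1 / 2) X ->
  1 / 2048 <= proba P [set w | (M%:R%:E < num_changes (@andor n) X w)%E].
Proof.
(* Chosen so that [2^m >= m = (16 M)^2]. *)
pose m := (256 * (M * M))%N.
have K0 : (0 < 2 ^ m)%N by rewrite expn_gt0.
have MK : 16 * M%:R <= Num.sqrt ((2 ^ m)%:R : R).
  have M0 : (0 : R) <= 16 * M%:R by rewrite mulr_ge0.
  rewrite -[leLHS]ger0_norm// -sqrtr_sqr ler_wsqrtr//.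
  rewrite exprMn -!natrX -natrM ler_nat; apply: leq_trans (ltnW (ltn_expl m (isT : 1 < 2)%N)).
  by rewrite /m !expnS !expn0 !muln1.
have [n0 H] := many_changes K0 MK.
exists n0 => d T P n X n0n HX; apply: le_trans (num_changes_gt_ge HX M m).
exact: H.
Qed.

(** * Lower limits in the depth *)

Section LimitsInferior.
Context {R : realType}.
Implicit Types (u v : (\bar R)^nat).
Local Open Scope ereal_scope.

Lemma limn_einf_ge u c n0 : (forall n, (n0 <= n)%N -> c <= u n) -> c <= limn_einf u.
Proof.
move=> cu; rewrite limn_einf_lim; apply: lime_ge; first exact: is_cvg_einfs.
exists n0 => // n /= n0n; apply: le_ereal_inf_tmp => _ [k /= nk <-].
by apply: cu; exact: leq_trans nk.
Qed.

Lemma le_limn_einf u v : (forall n, u n <= v n) -> limn_einf u <= limn_einf v.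
Proof.
move=> uv; rewrite !limn_einf_lim; apply: lee_lim; try exact: is_cvg_einfs.
apply: nearW => n; apply: le_ereal_inf_tmp => _ [k /= nk <-].
by apply: le_trans (uv k); apply: ereal_inf_lbound; exists k.
Qed.

End LimitsInferior.

Theorem theorem1p26 (R : realType) (d : nat -> measure_display)
    (T : forall n, measurableType (d n)) (P : forall n, probability (T n) R)
    (X : forall n, vertex n -> R -> T n -> bool)
    (HX : forall n, gate_dynamics (P n) (1 / 2) (X n)) :
  type2_semi_volatile P (fun n => num_changes (@andor n) (X n)) /\
  exists2 e : R, 0 < e & forall n : nat,
    (e%:E <= P n [set w | forall t : R, (0 <= t <= 1)%R ->
                            output (@andor n) (X n) t w = true]
          <= (1 - e)%:E)%E.
Proof.
have f0 : 0 < floor_const 8 <= (1 / 4 : R) := floor_const_gt0 8.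
split; last first.
  exists (floor_const 8); first by case/andP: f0.
  move=> n; rewrite probaE; last exact: (measurable_always (HX n) true).
  rewrite !lee_fin; have := always_ge (HX n) true; have := always_le (HX n) true.
  by rewrite /always; lra.
have mgt n (M : nat) := measurable_num_changes_gt (HX n) M.
split; first split.
- apply: (@lt_le_trans _ _ (floor_const 8)%:E); first by rewrite lte_fin; case/andP: f0.
  apply: (@limn_einf_ge _ _ _ 0) => n _.
  rewrite probaE ?lee_fin; first exact: (num_changes_eq0_ge (HX n)).
  by rewrite num_changes_eq0E; apply: measurableC; exact: mgt.
- apply: (@lt_le_trans _ _ (1 / 2048)%:E); first by rewrite lte_fin; lra.
  apply: lime_ge.
    (* The lower limits decrease in [M], so their limit exists, and the bound 1/2048, free of [M],
       passes to it. *)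
    apply: ereal_nonincreasing_is_cvgn => M M' MM'; apply: le_limn_einf => n.
    rewrite !probaE// lee_fin; apply: le_proba => // w /=.
    by apply: le_lt_trans; rewrite lee_fin ler_nat.
  apply: nearW => M.
  have [n0 Hn0] := num_changes_many R M.
  apply: (@limn_einf_ge _ _ _ n0) => n n0n.
  by rewrite probaE// lee_fin; exact: Hn0.
- exists 3%N => //; apply: (@lt_le_trans _ _ (1 / 8 * floor_const 8 ^+ 2)%:E).
    by rewrite lte_fin mulr_gt0 ?exprn_gt0//; case/andP: f0.
  (* Depth 0 is skipped because the bound needs a root with two children. A lower limit is bounded
     from below, which is more than the required upper limit. *)
  apply: le_trans (limn_einf_sup _); apply: (@limn_einf_ge _ _ _ 1) => -[//|n] _.
  rewrite probaE ?lee_fin; first exact: (num_changes_few (HX n.+1)).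
  by rewrite num_changes_betweenE; apply: measurableD; exact: mgt.
Qed.
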